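(* Let $\mathbb{F}$ be a field and let $0\neq q\in\mathbb{F}$ be an element which is not a root of unity. Let $n\ge1$ and $r\ge0$. Then the set $$\{\mathfrak{c}_\pi \mid \pi\in\mathrm{Walk}(r),\ \pi\to\lambda \text{ with } \lambda=(j^n) \text{ for some } j\ge0\}$$ is a basis of the space of invariants $(V_q^{\otimes r})^{U_q(\mathfrak{sl}_n)}$ for the restricted action of $U_q(\mathfrak{sl}_n)$ on $V_q^{\otimes r}$. Here $(j^n)=(j,j,\dots,j)$ ($n$ entries), $V_q$ is the vector representation of $U_q(\mathfrak{gl}_n)$, $\mathrm{Walk}(r)$ is the set of walks of length $r$ on the Bratteli diagram, $\pi\to\lambda$ means that $\pi$ terminates at $\lambda$, and $\mathfrak{c}_\pi\in V_q^{\otimes r}$ is the vector attached to $\pi$ (see the context).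
   Context: Notation: $[m]=(q^m-q^{-m})/(q-q^{-1})$ for $m\in\mathbb{Z}$. **Algebra.** $U_q(\mathfrak{gl}_n)$ is the $\mathbb{F}$-algebra with generators $E_i,F_i$ ($1\le i\le n-1$), $K_i^{\pm1}$ ($1\le i\le n$) and relations: $K_iK_j=K_jK_i$, $K_iK_i^{-1}=1=K_i^{-1}K_i$; $E_iF_j-F_jE_i=\delta_{ij}\frac{\tilde K_i-\tilde K_i^{-1}}{q-q^{-1}}$ with $\tilde K_i=K_iK_{i+1}^{-1}$; $K_iE_j=q^{\delta_{i,j}-\delta_{i,j+1}}E_jK_i$, $K_iF_j=q^{-(\delta_{i,j}-\delta_{i,j+1})}F_jK_i$; $E_i^2E_j-(q+q^{-1})E_iE_jE_i+E_jE_i^2=0$ if $|i-j|=1$, $E_iE_j=E_jE_i$ if $|i-j|>1$; and the same two relations with every $E$ replaced by $F$. Tensor products are formed with the coproduct $\Delta(E_i)=E_i\otimes1+\tilde K_i\otimes E_i$, $\Delta(F_i)=F_i\otimes\tilde K_i^{-1}+1\otimes F_i$, $\Delta(K_i)=K_i\otimes K_i$. $U_q(\mathfrak{sl}_n)$ is the subalgebra generated by all $E_i,F_i,\tilde K_i^{\pm1}$. Invariants are the vectors $v$ with $E_iv=0=F_iv$ and $\tilde K_iv=v$ for all $i$. A vector $v$ has weight $\mu\in\mathbb{Z}^n$ if $K_iv=q^{\mu_i}v$ for all $i$. The vector representation $V_q$ has basis $v_1,\dots,v_n$ with $K_jv_i=q^{\delta_{ij}}v_i$, $F_iv_i=v_{i+1}$,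 $E_iv_{i+1}=v_i$, and $F_i$, $E_i$ kill all other basis vectors. A maximal vector of weight $\lambda$ is a nonzero vector of weight $\lambda$ killed by all $E_i$. **The elements $\Psi_j$.** Fix a partition $\lambda$, extended by zeros, and put $\alpha_i^\vee(\lambda)=\lambda_i-\lambda_{i+1}$. Set $c_1=0$, $c_m=\lambda_2-\lambda_{m+1}+m-1$ ($m\ge2$), $d_m=\lambda_1-\lambda_{m+1}+m-1$ ($m\ge1$). Define $\Psi_0=1$, $\Psi_1=F_1/[d_1]$ and $\Psi_m=\frac1{[d_m]}\big([c_m]F_1\Psi_{m-1}^+-[c_m-1]\Psi_{m-1}^+F_1\big)$ for $m\ge2$. Here the superscript $+$ replaces each $F_i$ by $F_{i+1}$ and each $\alpha_i$ by $\alpha_{i+1}$ (i.e. each $\lambda_i$ by $\lambda_{i+1}$), and $+(k)$ means shifting $k$ times. **The operators $\Phi_m$.** If $b$ is a maximal vector of weight $\lambda$ in a $U_q(\mathfrak{gl}_n)$-module $M$, then $\Phi_1(b)=v_1\otimes b$ and, for $2\le m\le n$ with $\alpha_{m-1}^\vee(\lambda)\ne0$, $\Phi_m(b)=\sum_{j=0}^{m-1}(-q^{-1})^j\,v_{m-j}\otimes\Psi_j^{+(m-j-1)}b\in V_q\otimes M$. The $\Psi$'s are formed with respect to the weight $\lambda$ of $b$. **Walks.** The Bratteli diagram has as vertices at level $r$ the partitions of $r$ with at most $n$ parts, with an edge between vertices in successive levels that differ by one box. A walk of length $r$ is a sequence $\pi=(\emptyset=\pi^{(0)}\to\pi^{(1)}\to\cdots\to\pi^{(r)})$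 in which each $\pi^{(j)}$ is obtained from $\pi^{(j-1)}$ by adding one box. If that box lies in row $k$ put $\Upsilon_j=\Phi_k$. Then $\mathfrak{c}_\pi=\Upsilon_r\Upsilon_{r-1}\cdots\Upsilon_1(1)\in V_q^{\otimes r}$, where $1$ spans $V_q^{\otimes0}=\mathbb{F}$. *)

(* Defs.v *)
From HB Require Import structures.
From mathcomp Require Import all_boot all_order all_algebra.
From mathcomp Require Import zify ring.

Set Implicit Arguments.
Unset Strict Implicit.
Unset Printing Implicit Defensive.

Import Order.TTheory GRing.Theory Num.Theory.
Local Open Scope ring_scope.

(* All families of generators, basis vectors and parts of partitions are
   indexed by nat, starting from 1 as is customary; E_i, F_i are only
   meaningful for 0 < i < n and K_i, v_i only for 0 < i <= n. *)

Definition qint (F : fieldType) (q : F) (m : int) : F :=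
  (q ^ m - q ^ (- m)) / (q - q^-1).

(** * Modules over U_q(gl_n) *)

Record uq_ops (F : fieldType) := UqOps {
  uq_sort :> vectType F;
  actE : nat -> 'End(uq_sort);
  actF : nat -> 'End(uq_sort);
  actK : nat -> 'End(uq_sort);
  actKi : nat -> 'End(uq_sort)
}.
Arguments actE {F} u _.
Arguments actF {F} u _.
Arguments actK {F} u _.
Arguments actKi {F} u _.

Definition actKt (F : fieldType) (M : uq_ops F) (i : nat) : 'End(M) :=
  (actK M i \o actKi M i.+1)%VF.
Definition actKti (F : fieldType) (M : uq_ops F) (i : nat) : 'End(M) :=
  (actKi M i \o actK M i.+1)%VF.

(* The exponent of q in K_i E_j = q^(..) E_j K_i. *)
Definition Kexp (i j : nat) : int := (i == j)%:Z - (i == j.+1)%:Z.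

Definition qSerre (F : fieldType) (q : F) (V : vectType F) (x y : 'End(V)) :=
  ((x \o x \o y) - (q + q^-1) *: (x \o y \o x) + (y \o x \o x))%VF.

(* A module over the algebra presented by generators and relations is a vector
   space with operators satisfying the defining relations. *)
Record uqgl_module (F : fieldType) (q : F) (n : nat) (M : uq_ops F) : Prop := UqglModule {
  uq_KK : forall i j, (0 < i <= n)%N -> (0 < j <= n)%N ->
    (actK M i \o actK M j = actK M j \o actK M i)%VF;
  uq_KKi : forall i, (0 < i <= n)%N -> (actK M i \o actKi M i = \1)%VF;
  uq_KiK : forall i, (0 < i <= n)%N -> (actKi M i \o actK M i = \1)%VF;
  uq_EF : forall i j, (0 < i < n)%N -> (0 < j < n)%N ->
    ((actE M i \o actF M j) - (actF M j \o actE M i))%VF =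
      (i == j)%:R *: ((q - q^-1)^-1 *: (actKt M i - actKti M i));
  uq_KE : forall i j, (0 < i <= n)%N -> (0 < j < n)%N ->
    (actK M i \o actE M j)%VF = q ^ Kexp i j *: (actE M j \o actK M i)%VF;
  uq_KF : forall i j, (0 < i <= n)%N -> (0 < j < n)%N ->
    (actK M i \o actF M j)%VF = q ^ (- Kexp i j) *: (actF M j \o actK M i)%VF;
  uq_SerreE : forall i j, (0 < i < n)%N -> (0 < j < n)%N ->
    (j == i.+1) || (i == j.+1) -> qSerre q (actE M i) (actE M j) = 0;
  uq_farE : forall i j, (0 < i < n)%N -> (0 < j < n)%N ->
    (i.+1 < j)%N || (j.+1 < i)%N ->
    (actE M i \o actE M j = actE M j \o actE M i)%VF;
  uq_SerreF : forall i j, (0 < i < n)%N -> (0 < j < n)%N ->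
    (j == i.+1) || (i == j.+1) -> qSerre q (actF M i) (actF M j) = 0;
  uq_farF : forall i j, (0 < i < n)%N -> (0 < j < n)%N ->
    (i.+1 < j)%N || (j.+1 < i)%N ->
    (actF M i \o actF M j = actF M j \o actF M i)%VF
}.

(* The ground field, with the action through the counit. *)
Definition uq_triv (F : fieldType) : uq_ops F :=
  @UqOps F F^o (fun _ => 0) (fun _ => 0) (fun _ => \1%VF) (fun _ => \1%VF).

(** * The vector representation *)

Section VectorRep.
Variables (F : fieldType) (q : F) (n : nat).

(* v_m, with v_m = 0 unless 0 < m <= n. *)
Definition vbase (m : nat) : {ffun 'I_n -> F^o} := [ffun k : 'I_n => (k.+1 == m)%:R].

(* The linear endomorphism mapping v_k to f k for 0 < k <= n. *)
Definition on_vbase_fun (f : nat -> {ffun 'I_n -> F^o})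
    (x : {ffun 'I_n -> F^o}) : {ffun 'I_n -> F^o} :=
  \sum_(k < n) (x k : F) *: f k.+1.
Definition on_vbase f : 'End({ffun 'I_n -> F^o}) := linfun (on_vbase_fun f).

Definition Vq : uq_ops F := @UqOps F {ffun 'I_n -> F^o}
  (fun i => on_vbase (fun k => if k == i.+1 then vbase i else 0))
  (fun i => on_vbase (fun k => if k == i then vbase i.+1 else 0))
  (fun j => on_vbase (fun k => q ^+ (k == j) *: vbase k))
  (fun j => on_vbase (fun k => q ^- (k == j) *: vbase k)).

(** * The tensor product V_q (x) M *)

(* Since v_1, ..., v_n is a basis of V_q, every element of V_q (x) M is
   uniquely of the form \sum_k v_k (x) w_k; it is represented by the family
   (w_k)_k in M. *)

Definition tens (M : vectType F) (x : {ffun 'I_n -> F^o}) (b : M) :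
  {ffun 'I_n -> M} := [ffun k => (x k : F) *: b].

Definition tens_end_fun (M : vectType F) (A : 'End({ffun 'I_n -> F^o}))
    (B : 'End(M)) (w : {ffun 'I_n -> M}) : {ffun 'I_n -> M} :=
  \sum_(k < n) tens (A (vbase k.+1)) (B (w k)).
Definition tens_end (M : vectType F) A B : 'End({ffun 'I_n -> M}) :=
  linfun (tens_end_fun A B : _ -> {ffun 'I_n -> M}).

Definition Vq_tens (M : uq_ops F) : uq_ops F := @UqOps F {ffun 'I_n -> M}
  (fun i => tens_end (actE Vq i) \1 + tens_end (actKt Vq i) (actE M i))
  (fun i => tens_end (actF Vq i) (actKti M i) + tens_end \1 (actF M i))
  (fun i => tens_end (actK Vq i) (actK M i))
  (fun i => tens_end (actKi Vq i) (actKi M i)).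

Definition Vq_pow (r : nat) : uq_ops F := iter r Vq_tens (uq_triv F).

End VectorRep.

Definition invariants (F : fieldType) (n : nat) (M : uq_ops F) : {vspace M} :=
  (\bigcap_(1 <= i < n)
    (lker (actE M i) :&: lker (actF M i) :&: fixedSpace (actKt M i)))%VS.

(** * The elements Psi and the operators Phi *)

Section Psi.
Variables (F : fieldType) (q : F).

Definition Psi_c (lam : nat -> nat) (m : nat) : int :=
  if m == 1%N then 0 else (lam 2%N)%:Z - (lam m.+1)%:Z + m%:Z - 1.
Definition Psi_d (lam : nat -> nat) (m : nat) : int :=
  (lam 1%N)%:Z - (lam m.+1)%:Z + m%:Z - 1.

(* Psi_m as an operator on V, where X i is the action of F_i. *)
Fixpoint Psi (V : vectType F) (X : nat -> 'End(V)) (lam : nat -> nat)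
    (m : nat) {struct m} : 'End(V) :=
  match m with
  | 0 => \1%VF
  | 1 => (qint q (Psi_d lam 1))^-1 *: X 1%N
  | m'.+1 =>
      let Psi' := Psi (fun i => X i.+1) (fun i => lam i.+1) m' in
      (qint q (Psi_d lam m))^-1 *:
        (qint q (Psi_c lam m) *: (X 1%N \o Psi')
          - qint q (Psi_c lam m - 1) *: (Psi' \o X 1%N))%VF
  end.

Definition Psi_shift (M : uq_ops F) (lam : nat -> nat) (k m : nat) : 'End(M) :=
  Psi (fun i => actF M (i + k)) (fun i => lam (i + k)%N) m.

(* For m = 1 this is v_1 (x) b. *)
Definition Phi (n : nat) (M : uq_ops F) (lam : nat -> nat) (m : nat) (b : M) :
    Vq_tens q n M :=
  \sum_(j < m) (- q^-1) ^+ j *: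
    tens (vbase F n (m - j)) (Psi_shift M lam (m - j - 1) j b).

End Psi.

(** * Walks on the Bratteli diagram *)

(* The parts of a partition of size at most r are at most r, so that the
   vertices up to level r are elements of {ffun 'I_n -> 'I_r.+1}. *)
Definition bratteli_vertex n r (lev : nat) (mu : {ffun 'I_n -> 'I_r.+1}) : bool :=
  [forall i : 'I_n, forall k : 'I_n, (i <= k)%N ==> (mu k <= mu i)%N]
  && (\sum_i (mu i : nat) == lev)%N.

Definition add_box n r (mu nu : {ffun 'I_n -> 'I_r.+1}) : bool :=
  [exists k : 'I_n, [forall i : 'I_n, nu i == (mu i + (i == k))%N :> nat]].

(* The initial vertex is the empty partition, the only vertex of level 0. *)
Definition is_walk n r (pi : {ffun 'I_r.+1 -> {ffun 'I_n -> 'I_r.+1}}) : bool :=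
  [forall j : 'I_r.+1, bratteli_vertex j (pi j)]
  && [forall j : 'I_r, add_box (pi (widen_ord (leqnSn r) j)) (pi (lift ord0 j))].

Definition walk n r := {w : {ffun 'I_r.+1 -> {ffun 'I_n -> 'I_r.+1}} | is_walk w}.

(* The i-th part (i >= 1) of the j-th vertex, extended by zeros. *)
Definition wpart n r (pi : walk n r) (j i : nat) : nat :=
  \sum_(k < n | k.+1 == i) val pi (inord j) k.

(* The row of the box added in the step from level j to level j.+1. *)
Definition box_row n r (pi : walk n r) (j : nat) : nat :=
  (find (fun i => wpart pi j i < wpart pi j.+1 i)%N (iota 1 n)).+1.

Definition to_rectangle n r (pi : walk n r) : bool :=
  [exists j : 'I_r.+1, [forall i : 'I_n, val pi ord_max i == j]].

Fixpoint cvec (F : fieldType) (q : F) n r (pi : walk n r) (k : nat) : Vq_pow q n k :=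
  match k return Vq_pow q n k with
  | 0 => 1 : F^o
  | j.+1 => Phi q n (wpart pi j) (box_row pi j) (cvec q pi j)
  end.

Definition cwalk (F : fieldType) (q : F) n r (pi : walk n r) : Vq_pow q n r := cvec q pi r.

(* Main.v *)
Require Import Defs.
From HB Require Import structures.
From mathcomp Require Import all_boot all_order all_algebra.
From mathcomp Require Import zify ring.
Import GRing.Theory.
Local Open Scope ring_scope.

Set Implicit Arguments.
Unset Strict Implicit.
Unset Printing Implicit Defensive.

(* Write a vector of V_q (x) M as w = sum_k v_k (x) w_k. Then w is killed by all
   E_i iff w_(k+1) = - q E_k w_k and E_i w_k = 0 for i <> k, so the last nonzero
   component w_m of a maximal vector is a maximal vector of M. The vector
   Phi_m b is maximal with last component b; hence the vectors c_pi are linearly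
   independent by triangularity, without any semisimplicity argument.
   Conversely, a maximal w is reduced to 0 by subtracting Phi_m of its last
   component. The only obstruction is a last component b = w_m of weight lambda
   with lambda_(m-1) = lambda_m; then F_(m-1) b = 0 while b is a multiple of
   E_(m-1) w_(m-1), and nilpotency of F_(m-1) forces b = 0. So the c_pi form a
   basis of the maximal vectors, they are weight vectors, and the invariants are
   spanned by those whose weight is a rectangle, as F_i b = 0 for a maximal b
   with lambda_i = lambda_(i+1). *)

(** * q-integers *)

Section QNumbers.
Variables (F : fieldType) (q : F).
Hypotheses (hq0 : q != 0) (hq : forall k : nat, (0 < k)%N -> q ^+ k != 1).

Lemma expqz_eq1 (m : int) : (q ^ m == 1) = (m == 0).
Proof.
apply/idP/eqP => [|->]; last by rewrite expr0z eqxx.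
case: m => [[|k]|k] //; first by rewrite -exprnP (negbTE (hq _)).
by rewrite NegzE -exprnN invr_eq1 (negbTE (hq _)).
Qed.

Lemma subqV_neq0 : q - q^-1 != 0.
Proof.
rewrite subr_eq0; apply: contra (hq (isT : 0 < 2)%N) => /eqP e.
by rewrite expr2 {1}e mulVf.
Qed.

(** Up to a nonzero factor, [[m]] is [q^(2m) - 1]. *)
Lemma qint_eq0 (m : int) : (qint q m == 0) = (m == 0).
Proof.
have -> : qint q m = q ^ (- m) * (q ^ (m + m) - 1) / (q - q^-1).
  by rewrite /qint mulrBr mulr1 -expfzDr // addKr.
rewrite !mulf_eq0 invr_eq0 (negbTE subqV_neq0) orbF.
rewrite (negbTE (expfz_neq0 _ hq0)) subr_eq0 expqz_eq1; lia.
Qed.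

(** A nonzero multiple of [qint q (- N - 2)]; it is the scalar left over in both string arguments
    with [F_i] below. *)
Lemma subzV_neq0 (N : nat) : q ^ (- N%:Z - 2) - q ^ (N%:Z + 2) != 0.
Proof.
have := qint_eq0 (- N%:Z - 2); rewrite /qint mulf_eq0 invr_eq0.
rewrite (negbTE subqV_neq0) orbF (_ : - (- N%:Z - 2) = N%:Z + 2); last by lia.
by move=> ->; lia.
Qed.

Lemma qint0 : qint q 0 = 0.
Proof. by rewrite /qint oppr0 subrr mul0r. Qed.

(** With [a] the weight for [T_1] and [c = c_m], this merges the two terms of [E_1 Psi_m b] into
    one. *)
Lemma qint_split (a c : int) :
  qint q c * qint q (a + 1) - qint q (c - 1) * qint q a = qint q (a + c).
Proof.
rewrite /qint !opprD !opprK !expfzDr // -!invr_expz !expr1z.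
have := subqV_neq0; have := expfz_neq0 a hq0; have := expfz_neq0 c hq0.
move: (q ^ a) (q ^ c) => A C hC hA h; field.
rewrite hq0 hA hC andbT /= -expr2.
by rewrite subr_eq0 (negbTE (hq _)).
Qed.

(** This identity and the next are the induction steps for the coefficients of [Ti i x] and [T i x]
    in the commutator of [E_i] with a power of [F_i]. *)
Lemma qintD1r (a : int) : q ^ (a - 1) * qint q a + q ^ (a + a) = q ^ a * qint q (a + 1).
Proof.
rewrite /qint !opprD !expfzDr // -!invr_expz !expr1z.
have := subqV_neq0; have := expfz_neq0 a hq0; move: (q ^ a) => A hA h; field.
by rewrite hA hq0 /= -expr2 subr_eq0 hq.
Qed.

Lemma qintD1l (a : int) :
  q ^ (1 - a) * qint q a + q ^ (- (a + a)) = q ^ (- a) * qint q (a + 1).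
Proof.
rewrite /qint !opprD !expfzDr // -!invr_expz !expr1z.
have := subqV_neq0; have := expfz_neq0 a hq0; move: (q ^ a) => A hA h; field.
by rewrite hA hq0 /= -expr2 subr_eq0 hq.
Qed.

End QNumbers.

(** * Relations between E, F and K *)

(** The entry [a_ij] of the Cartan matrix of type A. *)
Definition Aexp (i j : nat) : int := Kexp i j - Kexp i.+1 j.

Lemma Aexpii i : Aexp i i = 2.
Proof. rewrite /Aexp /Kexp !eqxx; lia. Qed.

(** Relations in pointwise form for bare families of operators, [X] standing for the [F_i]. Detached
    from [uq_ops], they can be restated for families with shifted indices, which the recursion for
    [Psi] requires. *)
Record qrel (F : fieldType) (q : F) (V : vectType F) (n : nat)
    (E X T Ti : nat -> 'End(V)) : Prop := Qrel {
  qr_TTi : forall i, (0 < i < n)%N -> forall x, T i (Ti i x) = x;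
  qr_TiT : forall i, (0 < i < n)%N -> forall x, Ti i (T i x) = x;
  qr_TTiC : forall i j, (0 < i < n)%N -> (0 < j < n)%N -> forall x,
    T i (Ti j x) = Ti j (T i x);
  qr_TE : forall i j, (0 < i < n)%N -> (0 < j < n)%N -> forall x,
    T i (E j x) = q ^ Aexp i j *: E j (T i x);
  qr_TX : forall i j, (0 < i < n)%N -> (0 < j < n)%N -> forall x,
    T i (X j x) = q ^ (- Aexp i j) *: X j (T i x);
  qr_EX : forall i j, (0 < i < n)%N -> (0 < j < n)%N -> forall x,
    E i (X j x) = X j (E i x)
      + (i == j)%:R *: ((q - q^-1)^-1 *: (T i x - Ti i x));
  qr_XX : forall i j, (0 < i < n)%N -> (0 < j < n)%N -> (i.+1 < j)%N ->
    forall x, X i (X j x) = X j (X i x)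
}.

Section Relations.
Variables (F : fieldType) (q : F).
Hypotheses (hq0 : q != 0) (hq : forall k : nat, (0 < k)%N -> q ^+ k != 1).
Local Notation qrel := (qrel q).

(** Such an [h] is a translation, so it preserves equality and gaps of indices and hence every
    exponent in the relations. *)
Lemma qrel_reindex (V : vectType F) n n' (E X T Ti : nat -> 'End(V)) (h : nat -> nat) :
  (forall i, h i.+1 = (h i).+1) ->
  (forall i, (0 < i < n')%N -> (0 < h i < n)%N) ->
  qrel n E X T Ti -> qrel n' (E \o h) (X \o h) (T \o h) (Ti \o h).
Proof.
move=> hS hr; have [c hE] : exists c, forall i, h i = (c + i)%N.
  exists (h 0%N) => i; elim: i => [|i IH]; first by rewrite addn0.
  by rewrite hS IH addnS.
have hi i j : (h i == h j) = (i == j) by rewrite !hE eqn_add2l.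
have hA i j : Aexp (h i) (h j) = Aexp i j by rewrite /Aexp /Kexp -!hS !hi.
case=> r1 r2 r0 r3 r4 r5 r6; split=> /=.
- by move=> i /hr /r1.
- by move=> i /hr /r2.
- by move=> i j /hr hi' /hr hj'; apply: r0.
- by move=> i j /hr hi' /hr hj' x; rewrite r3 // hA.
- by move=> i j /hr hi' /hr hj' x; rewrite r4 // hA.
- by move=> i j /hr hi' /hr hj' x; rewrite r5 // hi.
- by move=> i j /hr hi' /hr hj' ij x; rewrite r6 // -hS !hE ltn_add2l.
Qed.

Section OneModule.
Variables (V : vectType F) (n : nat) (E X T Ti : nat -> 'End(V)).
Hypothesis R : qrel n E X T Ti.

Lemma Ti_weight i x (a : int) : (0 < i < n)%N ->
  T i x = q ^ a *: x -> Ti i x = q ^ (- a) *: x.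
Proof.
move=> hi Tx; rewrite -{2}(qr_TiT R hi x) Tx linearZ scalerA -expfzDr //.
by rewrite addNr expr0z scale1r.
Qed.

Lemma EX_weight i x (a : int) : (0 < i < n)%N -> T i x = q ^ a *: x ->
  E i (X i x) = X i (E i x) + qint q a *: x.
Proof.
move=> hi Tx; rewrite (qr_EX R) // eqxx scale1r (Ti_weight hi Tx) Tx.
by rewrite -scalerBl scalerA mulrC.
Qed.

Lemma EX_neq i j x : (0 < i < n)%N -> (0 < j < n)%N -> i != j ->
  E i (X j x) = X j (E i x).
Proof. by move=> hi hj /negbTE ij; rewrite (qr_EX R) // ij scale0r addr0. Qed.

Lemma TiX i j x : (0 < i < n)%N -> (0 < j < n)%N ->
  Ti i (X j x) = q ^ Aexp i j *: X j (Ti i x).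
Proof.
move=> hi hj; rewrite -{1}(qr_TTi R hi x); set y := Ti i x.
have : Ti i (T i (X j y)) = X j y by rewrite (qr_TiT R).
rewrite (qr_TX R) // linearZ /= => <-.
by rewrite scalerA -expfzDr // addrN expr0z scale1r.
Qed.

Lemma TiE i j x : (0 < i < n)%N -> (0 < j < n)%N ->
  Ti i (E j x) = q ^ (- Aexp i j) *: E j (Ti i x).
Proof.
move=> hi hj; rewrite -{1}(qr_TTi R hi x); set y := Ti i x.
have : Ti i (T i (E j y)) = E j y by rewrite (qr_TiT R).
rewrite (qr_TE R) // linearZ /= => <-.
by rewrite scalerA -expfzDr // addNr expr0z scale1r.
Qed.

Fixpoint lpow (f : 'End(V)) k : 'End(V) := if k is k'.+1 then (f \o lpow f k')%VF else \1%VF.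

Arguments lpow : simpl never.

Lemma lpowS f k x : lpow f k.+1 x = f (lpow f k x).
Proof. by rewrite /= comp_lfunE. Qed.

Lemma lpowSr f k x : lpow f k.+1 x = lpow f k (f x).
Proof.
elim: k => [|k IH]; first by rewrite lpowS !id_lfunE.
by rewrite lpowS IH lpowS.
Qed.

Lemma T_lpowX i k x : (0 < i < n)%N ->
  T i (lpow (X i) k x) = q ^ (- (k + k)%:Z) *: lpow (X i) k (T i x).
Proof.
move=> hi; elim: k x => [|k IH] x; first by rewrite !id_lfunE scale1r.
rewrite !lpowS (qr_TX R) // IH Aexpii linearZ scalerA -expfzDr //.
by congr (q ^ _ *: _); lia.
Qed.

Lemma Ti_lpowX i k x : (0 < i < n)%N ->
  Ti i (lpow (X i) k x) = q ^ (k + k)%:Z *: lpow (X i) k (Ti i x).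
Proof.
move=> hi; elim: k x => [|k IH] x; first by rewrite !id_lfunE scale1r.
rewrite !lpowS TiX // IH Aexpii linearZ scalerA -expfzDr //.
by congr (q ^ _ *: _); lia.
Qed.

(** Each extra [X i] contributes one more commutator [(T i - Ti i) / (q - q^-1)]; moved past the
    other factors, these add up to a q-integer. *)
Lemma E_lpowX i k x : (0 < i < n)%N ->
  E i (lpow (X i) k.+1 x) = lpow (X i) k.+1 (E i x)
   + ((q - q^-1)^-1 * qint q k.+1%:Z) *: lpow (X i) k
      (q ^ (- k%:Z) *: T i x - q ^ k%:Z *: Ti i x).
Proof.
move=> hi; have h := subqV_neq0 hq0 hq.
elim: k => [|k IH].
  rewrite !lpowS !id_lfunE (qr_EX R) // eqxx scale1r oppr0 expr0z !scale1r.
  by rewrite /qint divff // mulr1.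
rewrite lpowS (qr_EX R) // eqxx scale1r IH linearD /= -lpowS -addrA.
congr (_ + _); rewrite linearZ /= -lpowS T_lpowX // Ti_lpowX // !linearB !linearZ /=.
move: (lpow _ _ (T i x)) (lpow _ _ (Ti i x)) => u v.
rewrite !scalerN !scalerA addrACA -!opprD -!scalerDl; congr (_ *: _ - _ *: _).
- have := qintD1l hq0 hq k.+1%:Z.
  have -> : 1 - k.+1%:Z = - k%:Z by lia.
  have -> : k.+1%:Z + 1 = k.+2%:Z by lia.
  rewrite -PoszD => e; set d := (q - q^-1)^-1.
  transitivity (d * (q ^ (- k.+1%:Z) * qint q k.+2)); first by rewrite -e; ring.
  by ring.
- have := qintD1r hq0 hq k.+1%:Z.
  have -> : k.+1%:Z - 1 = k%:Z by lia.
  have -> : k.+1%:Z + 1 = k.+2%:Z by lia.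
  rewrite -PoszD => e; set d := (q - q^-1)^-1.
  transitivity (d * (q ^ k.+1%:Z * qint q k.+2)); first by rewrite -e; ring.
  by ring.
Qed.

(* A vector killed by E_i of weight -2 would generate an infinite string. *)
Lemma maximal_weightN2_eq0 i N x : (0 < i < n)%N ->
  (forall y, lpow (X i) N y = 0) ->
  E i x = 0 -> T i x = q ^ (- 2) *: x -> x = 0.
Proof.
move=> hi hN Ex Tx.
elim: N {hN}(hN x) => [|N IH] hx; first by rewrite -hx id_lfunE.
apply: IH; have := E_lpowX N x hi.
rewrite hx Ex !linear0 add0r Tx (Ti_weight hi Tx) !scalerA -!expfzDr // -scalerBl.
rewrite linearZ scalerA /= => /esym/eqP; rewrite scaler_eq0 => /orP[|/eqP//].
rewrite mulf_eq0 mulf_eq0 invr_eq0 (negbTE (subqV_neq0 hq0 hq)) qint_eq0 //=.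
by rewrite [- (- 2)]opprK (negbTE (subzV_neq0 hq0 hq N)).
Qed.

(* E^(k+1) F^k x is a nonzero multiple of E x for all k: induct on k, with x
   replaced by a combination of T x and T^-1 x. *)
Lemma E_eq0_of_weight0 i N x : (0 < i < n)%N ->
  (forall y, lpow (X i) N y = 0) ->
  X i (E i x) = 0 -> T i (E i x) = E i x -> E i x = 0.
Proof.
move=> hi hN XEx TEx.
elim: N x {hN}(hN x) XEx TEx => [|N IH] x hx XEx TEx.
  by rewrite -(id_lfunE x) hx linear0.
have ET : E i (T i x) = q ^ (- 2) *: E i x.
  by rewrite -TEx (qr_TE R) // Aexpii scalerA -expfzDr // expr0z scale1r.
have ETi : E i (Ti i x) = q ^ 2 *: E i x.
  have := qr_TE R hi hi (Ti i x); rewrite Aexpii (qr_TTi R) // => e.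
  by rewrite -(qr_TiT R hi (E i (Ti i x))) e linearZ /= -TEx (qr_TiT R) // TEx.
pose y := q ^ (- N%:Z) *: T i x - q ^ N%:Z *: Ti i x.
have Ey : E i y = (q ^ (- N%:Z - 2) - q ^ (N%:Z + 2)) *: E i x.
  by rewrite /y linearB !linearZ /= ET ETi scalerN !scalerA -!expfzDr // -scalerBl.
have c0 := subzV_neq0 hq0 hq N.
suff /eqP : E i y = 0 by rewrite Ey scaler_eq0 (negbTE c0) => /eqP.
apply: IH.
- have := E_lpowX N x hi; rewrite hx lpowSr XEx !linear0 add0r => /esym/eqP.
  rewrite scaler_eq0 mulf_eq0 invr_eq0 (negbTE (subqV_neq0 hq0 hq)).
  by rewrite qint_eq0 // => /eqP.
- by rewrite Ey linearZ /= XEx scaler0.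
- by rewrite Ey linearZ /= TEx.
Qed.

End OneModule.
End Relations.

(** * The elements Psi *)

(** Shifting the weight turns [d_m] into [c_(m+1) - 1], which is what makes the two terms of
    [E_2 Psi_(m+1) b] cancel. *)
Lemma Psi_cS lam m : (0 < m)%N ->
  Psi_c lam m.+1 = Psi_d (lam \o S) m + 1.
Proof. by case: m => // m _; rewrite /Psi_c /Psi_d /=; lia. Qed.

(** For [a] the weight that [lam] prescribes for [T_1], this makes [[a + c_m] / [d_m]] equal to 1 as
    soon as [[d_m]] is nonzero. *)
Lemma Psi_dE lam m : (0 < m)%N ->
  (lam 1%N)%:Z - (lam 2%N)%:Z + Psi_c lam m = Psi_d lam m.
Proof. by case: m => // -[|m] _; rewrite /Psi_c /Psi_d /=; lia. Qed.

Section PsiTheory.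
Variables (F : fieldType) (q : F).
Hypotheses (hq0 : q != 0) (hq : forall k : nat, (0 < k)%N -> q ^+ k != 1).
Local Notation qrel := (qrel q).

(** The recursion is uniform and includes [m = 0]: there [c_1 = 0] removes the first term, and
    [-[-1] = 1] leaves [F_1 / [d_1]]. *)
Lemma PsiS (V : vectType F) (X : nat -> 'End(V)) lam m x :
  Psi q X lam m.+1 x = (qint q (Psi_d lam m.+1))^-1 *:
    (qint q (Psi_c lam m.+1) *: X 1%N (Psi q (X \o S) (lam \o S) m x)
     - qint q (Psi_c lam m.+1 - 1) *: Psi q (X \o S) (lam \o S) m (X 1%N x)).
Proof.
have h := subqV_neq0 hq0 hq.
case: m => [|m]; last first.
  by rewrite [LHS]/= scale_lfunE add_lfunE opp_lfunE !scale_lfunE !comp_lfunE.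
have qN1 : qint q (0 - 1) = -1
    by rewrite /qint (_ : 0 - 1 = - (1 : int)) // opprK -invr_expz expr1z -opprB mulNr divff.
by rewrite /= scale_lfunE /Psi_c /= qint0 scale0r qN1 !id_lfunE scaleN1r opprK add0r.
Qed.

Lemma Psi_ext (V : vectType F) (X Y : nat -> 'End(V)) lam mu m x :
  X =1 Y -> lam =1 mu -> Psi q X lam m x = Psi q Y mu m x.
Proof.
elim: m X Y lam mu x => [|m IH] X Y lam mu x hX hl //.
rewrite !PsiS /Psi_c /Psi_d !hl !hX.
have {}IH z : Psi q (X \o S) (lam \o S) m z = Psi q (Y \o S) (mu \o S) m z.
  by apply: IH => i /=.
by rewrite !IH.
Qed.

(** Every monomial of [Psi_m] contains each of [F_1, ..., F_m] exactly once, so moving [A] through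
    it always collects the same power of [q]. *)
Lemma Psi_qcomm (V : vectType F) (X : nat -> 'End(V)) (A : 'End(V)) (e : nat -> int) lam m :
  (forall i x, (0 < i <= m)%N -> A (X i x) = q ^ e i *: X i (A x)) ->
  forall x, A (Psi q X lam m x) = q ^ (\sum_(i < m) e i.+1) *: Psi q X lam m (A x).
Proof.
elim: m X e lam => [|m IH] X e lam hA x.
  by rewrite big_ord0 expr0z scale1r !id_lfunE.
have hA' i y : (0 < i <= m)%N -> A ((X \o S) i y) = q ^ (e \o S) i *: (X \o S) i (A y).
  by move=> hi; apply: hA; lia.
have {}IH := IH (X \o S) (e \o S) (lam \o S) hA'.
rewrite !PsiS linearZ linearB !linearZ /= (IH (X 1%N x)) !hA // (IH x) big_ord_recl.
rewrite -[\sum_(i < m) e (bump 0 i).+1]/(\sum_(i < m) e i.+2) /= expfzDr //.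
move: (\sum_(i < m) _) => s; rewrite !linearZ /= !scalerN !scalerBr !scalerA.
by congr (_ *: _ - _ *: _); ring.
Qed.

Lemma Psi_comm (V : vectType F) (X : nat -> 'End(V)) (A : 'End(V)) lam m :
  (forall i x, (0 < i <= m)%N -> A (X i x) = X i (A x)) ->
  forall x, A (Psi q X lam m x) = Psi q X lam m (A x).
Proof.
move=> hA x; rewrite (@Psi_qcomm _ _ _ (fun=> 0)).
  by rewrite sumr_const mul0rn expr0z scale1r.
by move=> i y hi; rewrite expr0z scale1r hA.
Qed.

(** Here [d_m >= lam_1 - lam_(m+1) >= lam_m - lam_(m+1) > 0]. *)
Lemma qint_Psi_d_neq0 (lam : nat -> nat) m :
  (forall i, (0 < i)%N -> (lam i.+1 <= lam i)%N) ->
  (0 < m)%N -> (lam m.+1 < lam m)%N -> qint q (Psi_d lam m) != 0.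
Proof.
move=> dom m0 strict; rewrite qint_eq0 // /Psi_d.
have : (lam m <= lam 1%N)%N.
  by case: m m0 {strict} => // m _; elim: m => // m; apply: leq_trans; exact: dom.
lia.
Qed.

(* Psi_m has to be applied to F_1 b, whose weight is not lam, in the
   recursion; hence the arbitrary weight a for T_1. *)
Lemma Psi_maximal (V : vectType F) n (E X T Ti : nat -> 'End(V)) lam m b (a : int) :
  qrel n E X T Ti -> (m < n)%N ->
  (forall i, (0 < i)%N -> (lam i.+1 <= lam i)%N) ->
  ((0 < m)%N -> (lam m.+1 < lam m)%N) ->
  (forall i, (0 < i < n)%N -> E i b = 0) ->
  ((1 < n)%N -> T 1%N b = q ^ a *: b) ->
  (forall i, (1 < i < n)%N -> T i b = q ^ ((lam i)%:Z - (lam i.+1)%:Z) *: b) ->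
  (forall i, (1 < i < n)%N -> E i (Psi q X lam m b) = 0) /\
  ((0 < m)%N -> E 1%N (Psi q X lam m b) =
     (qint q (a + Psi_c lam m) / qint q (Psi_d lam m)) *:
       Psi q (X \o S) (lam \o S) m.-1 b).
Proof.
elim: m n E X T Ti lam b a => [|m IH] n E X T Ti lam b a R mn dom strict Eb T1b Tb.
  split=> // i /andP[i1 i2]; rewrite id_lfunE Eb // i2; lia.
set psi := Psi q (X \o S) (lam \o S) m.
have R' : qrel n.-1 (E \o S) (X \o S) (T \o S) (Ti \o S).
  by apply: (qrel_reindex (n := n)) => // i; lia.
have h1 : (0 < 1 < n)%N by lia.
have dom' i : (0 < i)%N -> ((lam \o S) i.+1 <= (lam \o S) i)%N by move=> _; apply: dom.
have strict' : (0 < m)%N -> ((lam \o S) m.+1 < (lam \o S) m)%N by move=> _; apply: strict.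
have mn' : (m < n.-1)%N by lia.
(* For the shifted operators [b] has the weight prescribed by the shifted [lam], so the scalar in
   the induction hypothesis is 1. *)
have [IHb IHb1] : (forall i, (1 < i < n.-1)%N -> (E \o S) i (psi b) = 0) /\
  ((0 < m)%N -> (E \o S) 1%N (psi b) = Psi q ((X \o S) \o S) ((lam \o S) \o S) m.-1 b).
  have [] := IH _ _ _ _ _ (lam \o S) b ((lam 2%N)%:Z - (lam 3%N)%:Z) R' mn' dom' strict'.
  - by move=> i hi; apply: Eb => /=; lia.
  - by move=> hn; apply: Tb; lia.
  - by move=> i hi; apply: Tb => /=; lia.
  move=> H1 H2; split=> // m0; rewrite H2 // (Psi_dE (lam \o S) m0) divff ?scale1r //.
  by apply: qint_Psi_d_neq0 => //; apply: strict'.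
pose X1b := X 1%N b.
have EX1 i x : (1 < i < n)%N -> E i (X 1%N x) = X 1%N (E i x).
  by move=> hi; apply: (EX_neq R); lia.
(* [F_1] raises the weight for [T_2] by one and leaves the later ones alone; hence the extra 1 in
   the scalar. *)
have [IHx IHx1] : (forall i, (1 < i < n.-1)%N -> (E \o S) i (psi X1b) = 0) /\
  ((0 < m)%N -> (E \o S) 1%N (psi X1b) =
   (qint q (Psi_d (lam \o S) m + 1) / qint q (Psi_d (lam \o S) m)) *:
     Psi q ((X \o S) \o S) ((lam \o S) \o S) m.-1 X1b).
  have [] := IH _ _ _ _ _ (lam \o S) X1b ((lam 2%N)%:Z - (lam 3%N)%:Z + 1) R' mn' dom' strict'.
  - by move=> i hi /=; rewrite EX1 ?Eb ?linear0 //; lia.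
  - move=> hn /=; rewrite (qr_TX R) ?Tb /X1b; try lia.
    by rewrite linearZ scalerA -expfzDr // addrC.
  - move=> i hi /=; rewrite (qr_TX R) ?Tb /X1b; try lia.
    rewrite linearZ scalerA -expfzDr //; congr (q ^ _ *: _).
    by rewrite /Aexp /Kexp; lia.
  by move=> H1 H2; split=> // m0; rewrite H2 // -(Psi_dE (lam \o S) m0) addrAC.
have Epsi x : E 1%N (psi x) = psi (E 1%N x).
  by apply: Psi_comm => i y hi; apply: (EX_neq R); lia.
split=> [i hi|_].
  rewrite PsiS linearZ linearB !linearZ /= EX1 // -/psi -/X1b.
  case: (ltngtP i 2) hi => [|i2|->] hi; first lia.
    case: i hi i2 => // i hi i2.
    by rewrite [E _ (psi b)]IHb ?[E _ (psi X1b)]IHx ?(linear0, scaler0, oppr0, addr0) //; lia.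
  (* The case of [E_2]. For [m > 0] both terms are multiples of one vector, with coefficients [[c]]
     and [[c - 1] [c] / [d]], where [c = c_(m+1)] and the shifted [d_m] is [d = c - 1]. *)
  have [m0|m0] := posnP m.
    have psi1 z : psi z = z by rewrite /psi m0 id_lfunE.
    by rewrite !psi1 EX1 ?Eb ?(linear0, scaler0, oppr0, addr0) //; lia.
  rewrite [E _ (psi b)]IHb1 // [E _ (psi X1b)]IHx1 // -Psi_cS //.
  have -> : X 1%N (Psi q ((X \o S) \o S) ((lam \o S) \o S) m.-1 b)
      = Psi q ((X \o S) \o S) ((lam \o S) \o S) m.-1 X1b.
    by apply: Psi_comm => j y hj; apply: (qr_XX R); lia.
  rewrite Psi_cS // addrK scalerN scalerA mulrC divfK ?subrr ?scaler0 //.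
  by apply: qint_Psi_d_neq0 => //; apply: strict'.
(* [E_1] commutes with [psi], so only its commutators with [F_1] remain: they give [[a + 1]] in the
   first term and [[a]] in the second. *)
rewrite PsiS linearZ linearB !linearZ /= Epsi -/psi.
have -> : qint q (Psi_c lam m.+1) *: E 1%N (X 1%N (psi b)) =
   (qint q (Psi_c lam m.+1) * qint q (a + 1)) *: psi b.
  (* For [m = 0] the weight of [psi b] is [a] instead of [a + 1], but then the coefficient [[c_1]]
     is 0. For [m > 0] only the factor [F_2] of [psi] changes the weight for [T_1]. *)
  have [m0|m0] := posnP m; first by rewrite m0 /Psi_c /= qint0 !scale0r mul0r scale0r.
  have Tpsi : T 1%N (psi b) = q ^ (a + 1) *: psi b.
    rewrite (@Psi_qcomm _ _ _ (fun i => - Aexp 1 i.+1)); last first.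
      by move=> i y hi; apply: (qr_TX R); lia.
    rewrite T1b; last by lia.
    rewrite linearZ scalerA -expfzDr // addrC; congr (q ^ (_ + _) *: _).
    case: (m) m0 => // k _; rewrite big_ord_recl big1 => [|i _].
      by rewrite /Aexp /Kexp.
    by rewrite /Aexp /Kexp /bump /=; lia.
  by rewrite (EX_weight hq0 R h1 Tpsi) Epsi Eb // !linear0 add0r scalerA.
rewrite (EX_weight hq0 R h1 (T1b _)); last by lia.
rewrite Eb // linear0 add0r linearZ /= scalerN scalerA -scalerBl.
by rewrite (qint_split hq0 hq) scalerA mulrC.
Qed.

End PsiTheory.

(** * The tensor product of V_q with a module *)

Section Components.
Variables (F : fieldType) (n : nat).

(** The component at [v_m]; the sum makes it 0 for [m] outside [1..n] and avoids ordinal casts. *)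
Definition co (M : vectType F) (m : nat) (w : {ffun 'I_n -> M}) : M :=
  \sum_(k < n | k.+1 == m) w k.

Lemma co_is_linear M m : linear (@co M m).
Proof.
move=> a u v; rewrite /co scaler_sumr -big_split /=.
by apply: eq_bigr => k _; rewrite !ffunE.
Qed.
HB.instance Definition _ (M : vectType F) (m : nat) :=
  GRing.isLinear.Build F {ffun 'I_n -> M} M *:%R (@co M m) (@co_is_linear M m).

Lemma co_ord (M : vectType F) (w : {ffun 'I_n -> M}) (k : 'I_n) : co k.+1 w = w k.
Proof.
rewrite /co (big_pred1 k) // => j /=; exact: eqSS.
Qed.

Lemma co_inj (M : vectType F) (w w' : {ffun 'I_n -> M}) :
  (forall m, (0 < m <= n)%N -> co m w = co m w') -> w = w'.
Proof.
by move=> h; apply/ffunP => k; rewrite -!co_ord h //= ltn_ord.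
Qed.

Lemma co_vbase m p : (0 < m <= n)%N -> co m (vbase F n p) = (m == p)%:R.
Proof.
case: m => // m /= mn; rewrite (co_ord _ (Ordinal mn)) ffunE //.
Qed.

Lemma co_tens (M : vectType F) m x (b : M) : co m (tens x b) = (co m x : F) *: b.
Proof.
by rewrite /co scaler_suml; apply: eq_bigr => k _; rewrite ffunE.
Qed.

Lemma on_vbase_fun_is_linear f : linear (@on_vbase_fun F n f).
Proof.
move=> a u v; rewrite /on_vbase_fun scaler_sumr -big_split /=.
by apply: eq_bigr => k _; rewrite !ffunE scalerDl scalerA.
Qed.
HB.instance Definition _ f :=
  GRing.isLinear.Build F {ffun 'I_n -> F^o} {ffun 'I_n -> F^o} *:%R _ (on_vbase_fun_is_linear f).

Lemma on_vbaseE f p : (0 < p <= n)%N -> on_vbase f (vbase F n p) = f p.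
Proof.
case: p => // p pn; rewrite lfunE /= /on_vbase_fun (bigD1 (Ordinal pn)) //=.
rewrite ffunE eqxx scale1r big1 ?addr0 // => k hk.
by rewrite ffunE eqSS (negbTE (_ : k != p :> nat)) ?scale0r.
Qed.

Lemma tens_end_fun_is_linear (M : vectType F) A (B : 'End(M)) : linear (@tens_end_fun F n M A B).
Proof.
move=> a u v; rewrite /tens_end_fun scaler_sumr -big_split /=.
apply: eq_bigr => k _; apply/ffunP => l; rewrite !ffunE linearP scalerDr !scalerA.
by rewrite mulrC.
Qed.
HB.instance Definition _ (M : vectType F) A B :=
  GRing.isLinear.Build F {ffun 'I_n -> M} {ffun 'I_n -> M} *:%R _ (@tens_end_fun_is_linear M A B).

Lemma co_tens_end (M : vectType F) (A : 'End({ffun 'I_n -> F^o})) (B : 'End(M)) m w :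
  co m (tens_end A B w) = \sum_(k < n) (co m (A (vbase F n k.+1)) : F) *: B (w k).
Proof.
rewrite lfunE /= /tens_end_fun linear_sum.
by apply: eq_bigr => k _; rewrite /= co_tens.
Qed.

Lemma co_tens_end_diag (M : vectType F) (A : 'End({ffun 'I_n -> F^o})) (B : 'End(M)) (c : nat -> F) m w :
  (forall p, (0 < p <= n)%N -> A (vbase F n p) = c p *: vbase F n p) ->
  (0 < m <= n)%N -> co m (tens_end A B w) = c m *: B (co m w).
Proof.
move=> hA hm; rewrite co_tens_end; case: m hm => // m mn.
rewrite (bigD1 (Ordinal mn)) //= big1 => [|k hk].
  by rewrite hA ?mn // linearZ /= co_vbase // eqxx (co_ord w (Ordinal mn)) [_ *: 1]mulr1 addr0.
rewrite hA ?ltn_ord // linearZ /= co_vbase // eqSS eq_sym.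
by rewrite (negbTE (_ : k != m :> nat)) // scaler0 scale0r.
Qed.

Lemma co_tens_end_unit (M : vectType F) (A : 'End({ffun 'I_n -> F^o})) (B : 'End(M)) s t m w :
  (forall p, (0 < p <= n)%N -> A (vbase F n p) = if p == s then vbase F n t else 0) ->
  (0 < m <= n)%N -> co m (tens_end A B w) = (m == t)%:R *: B (co s w).
Proof.
move=> hA hm; rewrite co_tens_end /co linear_sum scaler_sumr big_mkcond [RHS]big_mkcond /=.
apply: eq_bigr => k _; rewrite hA ?ltn_ord //.
case: eqP => _; last by rewrite -/(co m _) linear0 scale0r.
by rewrite -/(co m _) co_vbase.
Qed.

End Components.

Section TensorModule.
Variables (F : fieldType) (q : F) (n : nat).
Hypotheses (hq0 : q != 0) (hq : forall k : nat, (0 < k)%N -> q ^+ k != 1).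

Lemma KtVq i p : (0 < p <= n)%N ->
  actKt (Vq q n) i (vbase F n p) = q ^ Kexp p i *: vbase F n p.
Proof.
move=> hp; rewrite /actKt comp_lfunE on_vbaseE // linearZ /= on_vbaseE // scalerA.
by rewrite !exprnP invr_expz -expfzDr // addrC.
Qed.

Variable M : uq_ops F.
Local Notation VM := (Vq_tens q n M).
Implicit Types (w : VM) (m i : nat).

Lemma co_K m i w : (0 < m <= n)%N ->
  co m (actK VM i w) = q ^+ (m == i) *: actK M i (co m w).
Proof.
move=> hm; apply: (@co_tens_end_diag _ _ _ _ _ (fun m => q ^+ (m == i))) => // p hp.
by rewrite on_vbaseE.
Qed.

Lemma co_Ki m i w : (0 < m <= n)%N ->
  co m (actKi VM i w) = q ^- (m == i) *: actKi M i (co m w).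
Proof.
move=> hm; apply: (@co_tens_end_diag _ _ _ _ _ (fun m => q ^- (m == i))) => // p hp.
by rewrite on_vbaseE.
Qed.

Lemma co_Kt m i w : (0 < m <= n)%N ->
  co m (actKt VM i w) = q ^ Kexp m i *: actKt M i (co m w).
Proof.
move=> hm; rewrite /actKt !comp_lfunE co_K // co_Ki // linearZ /= scalerA.
by rewrite !exprnP invr_expz -expfzDr.
Qed.

Lemma co_Kti m i w : (0 < m <= n)%N ->
  co m (actKti VM i w) = q ^ (- Kexp m i) *: actKti M i (co m w).
Proof.
move=> hm; rewrite /actKti !comp_lfunE co_Ki // co_K // linearZ /= scalerA.
by rewrite !exprnP invr_expz -expfzDr // opprB addrC.
Qed.

(** The first summand of the coproduct moves the component at [v_(i+1)] to [v_i], the second acts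
    within each component. This turns maximality into relations between neighbouring components. *)
Lemma co_E m i w : (0 < m <= n)%N ->
  co m (actE VM i w) = (m == i)%:R *: co i.+1 w + q ^ Kexp m i *: actE M i (co m w).
Proof.
move=> hm; rewrite /= add_lfunE linearD /=; congr (_ + _).
  rewrite (@co_tens_end_unit _ _ _ _ _ i.+1 i) ?id_lfunE // => p hp.
  by rewrite on_vbaseE.
apply: (@co_tens_end_diag _ _ _ _ _ (fun m => q ^ Kexp m i)) => // p; exact: KtVq.
Qed.

Lemma co_F m i w : (0 < m <= n)%N ->
  co m (actF VM i w) = (m == i.+1)%:R *: actKti M i (co i w) + actF M i (co m w).
Proof.
move=> hm; rewrite /= add_lfunE linearD /=; congr (_ + _).
  rewrite (@co_tens_end_unit _ _ _ _ _ i i.+1) // => p hp.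
  by rewrite on_vbaseE.
rewrite (@co_tens_end_diag _ _ _ _ _ (fun m => 1)) ?scale1r // => p hp.
by rewrite id_lfunE scale1r.
Qed.

Definition F_nilpotent (N : uq_ops F) :=
  exists d, forall i, (0 < i < n)%N -> forall x, lpow (actF N i) d x = 0.

(* After d steps only the component at v_(i+1) survives, and F_i acts on such
   vectors componentwise. *)
Lemma F_nilpotent_tens : F_nilpotent M -> F_nilpotent VM.
Proof.
case=> d hd; exists (d + d)%N => i hi x.
have other y e m : (0 < m <= n)%N -> m != i.+1 ->
    co m (lpow (actF VM i) e y) = lpow (actF M i) e (co m y).
  move=> hm mi; elim: e => [|e IH]; first by rewrite !id_lfunE.
  by rewrite !lpowS co_F // (negbTE mi) scale0r add0r IH.
have lpowD e y : lpow (actF VM i) (e + d) y = lpow (actF VM i) e (lpow (actF VM i) d y).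
  by elim: e => [|e IH]; rewrite ?id_lfunE // addSn !lpowS IH.
have hi0 : (0 < i <= n)%N by lia.
have ii : i != i.+1 by lia.
rewrite lpowD; set y := lpow _ d x; apply: co_inj => m hm; rewrite linear0.
have [->|mi] := eqVneq m i.+1; last by rewrite other // hd.
have y0 e : co i (lpow (actF VM i) e y) = 0.
  by rewrite other // /y other // hd // linear0.
have hi1 : (0 < i.+1 <= n)%N by lia.
suff -> e : co i.+1 (lpow (actF VM i) e y) = lpow (actF M i) e (co i.+1 y) by rewrite hd.
elim: e => [|e IH]; first by rewrite !id_lfunE.
by rewrite !lpowS co_F // eqxx y0 linear0 scaler0 add0r IH.
Qed.

Definition uq_rel (N : uq_ops F) := qrel q n (actE N) (actF N) (actKt N) (actKti N).

(** This identity and the next give the components at [v_i] and [v_(i+1)] of the commutation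
    relation of [E_i] and [F_i] on the tensor product. *)
Lemma EF_top (V : lmodType F) (a f g t : V) (d := (q - q^-1)^-1) :
  a + f + q *: (g + d *: (t - a)) = f + q *: g + (d *: (q *: t) + d *: (q^-1 *: - a)).
Proof.
have dq : d * q = 1 + d * q^-1.
  by rewrite -[X in X + _](mulVf (subqV_neq0 hq0 hq)) -mulrDr subrK.
rewrite !scalerDr !scalerN !scalerA [q * d]mulrC dq !scalerDl !scale1r opprD -!addrA.
by do 4!(rewrite [LHS]addrCA; congr (_ + _)); rewrite addNKr.
Qed.

Lemma EF_bottom (V : lmodType F) (a e g t : V) (d := (q - q^-1)^-1) :
  q^-1 *: e + q^-1 *: (g + d *: (t - a)) =
  a + q^-1 *: e + q^-1 *: g + (d *: (q^-1 *: t) + d *: (q *: - a)).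
Proof.
have dq : d * q = 1 + d * q^-1.
  by rewrite -[X in X + _](mulVf (subqV_neq0 hq0 hq)) -mulrDr subrK.
rewrite !scalerDr !scalerN !scalerA [q^-1 * d]mulrC dq !scalerDl !scale1r opprD.
by rewrite -!addrA; do 3!(rewrite [RHS]addrCA; congr (_ + _)); rewrite addNKr.
Qed.

Lemma uq_rel_tens : uq_rel M -> uq_rel VM.
Proof.
move=> R; split.
- move=> i hi x; apply: co_inj => m hm.
  by rewrite co_Kt // co_Kti // linearZ /= (qr_TTi R) // scalerA -expfzDr // addrN expr0z scale1r.
- move=> i hi x; apply: co_inj => m hm.
  by rewrite co_Kti // co_Kt // linearZ /= (qr_TiT R) // scalerA -expfzDr // addNr expr0z scale1r.
- move=> i j hi hj x; apply: co_inj => m hm.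
  rewrite (co_Kt i (actKti VM j x) hm) (co_Kti j x hm) (co_Kti j (actKt VM i x) hm).
  rewrite (co_Kt i x hm) linearZ /= [actKti M j (_ *: _)]linearZ /= (qr_TTiC R) // !scalerA.
  by rewrite mulrC.
- move=> i j hi hj x; apply: co_inj => m hm.
  have hj1 : (0 < j.+1 <= n)%N by lia.
  rewrite linearZ /= (co_Kt i (actE VM j x) hm) (co_E j x hm) (co_E j (actKt VM i x) hm).
  rewrite (co_Kt i x hm) (co_Kt i x hj1) !linearD !linearZ /=.
  rewrite (qr_TE R) // !linearZ /= !scalerA -!expfzDr //; congr (_ *: _ + _ *: _).
  case: eqP => [->|_]; last by rewrite /= !(mulr0n, mulr0, mul0r).
  by rewrite /= !(mulr1n, mulr1, mul1r) /Aexp /Kexp; congr (q ^ _); lia.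
- move=> i j hi hj x; apply: co_inj => m hm.
  have hj0 : (0 < j <= n)%N by lia.
  rewrite linearZ /= (co_Kt i (actF VM j x) hm) (co_F j x hm) (co_F j (actKt VM i x) hm).
  rewrite (co_Kt i x hm) (co_Kt i x hj0) !linearD !linearZ /=.
  rewrite (qr_TX R) // (qr_TTiC R) // !linearZ /= !scalerA -!expfzDr //; congr (_ *: _ + _ *: _).
  case: eqP => [->|_]; last by rewrite /= !(mulr0n, mulr0, mul0r).
  by rewrite /= !(mulr1n, mulr1, mul1r) /Aexp /Kexp; congr (q ^ _); lia.
- move=> i j hi hj x; apply: co_inj => m hm.
  have hi1 : (0 < i.+1 <= n)%N by lia.
  have hj0 : (0 < j <= n)%N by lia.
  rewrite linearD /= (co_E i (actF VM j x) hm) (co_F j x hm) (co_F j x hi1).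
  rewrite (co_F j (actE VM i x) hm) (co_E i x hm) (co_E i x hj0).
  rewrite 2!linearZ /= linearB /= (co_Kt i x hm) (co_Kti i x hm).
  have bS : (i.+1 == j.+1) = (i == j) by rewrite eqSS.
  rewrite bS [j == i]eq_sym; case: (eqVneq i j) => [ij|ij]; last first.
    rewrite !scale0r !add0r addr0 !linearD !linearZ /= (EX_neq R) //.
    rewrite (TiE hq0 R) // !scalerA addrCA; congr (_ *: _ + _).
    case: eqP => [->|_]; last by rewrite /= !(mulr0n, mulr0, mul0r).
    by rewrite /= !(mulr1n, mulr1, mul1r) -expfzDr // /Aexp; congr (q ^ _); lia.
  subst j; rewrite !linearD !linearZ /= (qr_EX R) // eqxx.
  rewrite (TiE hq0 R) // Aexpii /= !mulr1n !scale1r.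
  (* Terms mixing the two tensor factors survive only at [v_i] and [v_(i+1)]; at the other
     components the relation of [M] carries over. *)
  case: (eqVneq m i) => [mi|mi].
    have -> : (m == i.+1) = false by lia.
    have -> : Kexp m i = 1 by rewrite mi /Kexp; lia.
    rewrite mi !expr1z.
    by rewrite !(mulr1n, mulr0n, scale0r, scale1r, scaler0, add0r) -exprN1 -EF_top.
  case: (eqVneq m i.+1) => [mi'|mi'].
    have -> : Kexp m i = -1 by rewrite mi' /Kexp; lia.
    rewrite mi' opprK expr1z !(mulr1n, mulr0n, scale0r, scale1r, scaler0, add0r, addr0).
    have -> : Kexp i i = 1 by rewrite /Kexp; lia.
    have q2 (v : M) : q *: (q ^ (- 2) *: v) = q^-1 *: v.
      by rewrite scalerA -{1}[q]expr1z -expfzDr // -exprN1.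
    by rewrite expr1z q2 exprN1 EF_bottom.
  have -> : Kexp m i = 0 by rewrite /Kexp; lia.
  by rewrite !(mulr0n, scale0r) !add0r oppr0 expr0z !scale1r scaler0 add0r -scalerDr.
move=> i j hi hj ij x; apply: co_inj => m hm.
have hi0 : (0 < i <= n)%N by lia.
have hj0 : (0 < j <= n)%N by lia.
rewrite (co_F i (actF VM j x) hm) (co_F j x hm) (co_F j x hi0).
rewrite (co_F j (actF VM i x) hm) (co_F i x hm) (co_F i x hj0).
have -> : (i == j.+1) = false by lia.
have -> : (j == i.+1) = false by lia.
have A0 : Aexp i j = 0 by rewrite /Aexp /Kexp; lia.
have A0' : Aexp j i = 0 by rewrite /Aexp /Kexp; lia.
rewrite !scale0r !add0r !linearD !linearZ /= !(TiX hq0 R) // A0 A0' expr0z !scale1r.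
by rewrite (qr_XX R) // addrCA.
Qed.

Lemma uq_rel_triv : uq_rel (uq_triv F).
Proof.
split=> /=.
- by move=> *; rewrite /actKt /actKti /= !comp_lfunE !id_lfunE.
- by move=> *; rewrite /actKt /actKti /= !comp_lfunE !id_lfunE.
- by move=> *; rewrite /actKt /actKti /= !comp_lfunE !id_lfunE.
- by move=> *; rewrite zero_lfunE linear0 !zero_lfunE scaler0.
- by move=> *; rewrite zero_lfunE linear0 !zero_lfunE scaler0.
- move=> *; rewrite !zero_lfunE add0r /actKt /actKti /= !comp_lfunE !id_lfunE.
  by rewrite subrr !scaler0.
- by move=> *; rewrite zero_lfunE.
Qed.

Lemma F_nilpotent_triv : F_nilpotent (uq_triv F).
Proof. by exists 1%N => i hi x; rewrite lpowS zero_lfunE. Qed.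

End TensorModule.

(** * Maximality and weight of the vectors built by [Phi] *)

Section Phi.
Variables (F : fieldType) (q : F) (n : nat).
Hypotheses (hq0 : q != 0) (hq : forall k : nat, (0 < k)%N -> q ^+ k != 1).
Variables (M : uq_ops F) (R : uq_rel q n M) (lam : nat -> nat) (b : M).
Local Notation VM := (Vq_tens q n M).

Lemma co_Phi m k : (0 < k <= n)%N -> (m <= n)%N ->
  co k (Phi q n lam m b) =
    if (k <= m)%N then (- q^-1) ^+ (m - k) *: Psi_shift q M lam (k - 1) (m - k) b else 0.
Proof.
move=> hk mn; rewrite /Phi linear_sum /=.
under eq_bigr => j _ do rewrite linearZ /= co_tens co_vbase //.
case: leqP => km.
  have jm : (m - k < m)%N by lia.
  rewrite (bigD1 (Ordinal jm)) //= subKn // eqxx mulr1n scale1r big1 ?addr0 // => j hj.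
  have -> : (k == m - j)%N = false by move: (ltn_ord j) hj; rewrite -val_eqE /=; lia.
  by rewrite scale0r scaler0.
rewrite big1 // => j _; have -> : (k == m - j)%N = false by lia.
by rewrite scale0r scaler0.
Qed.

Hypothesis dom : forall i, (0 < i)%N -> (lam i.+1 <= lam i)%N.
Hypothesis Eb : forall i, (0 < i < n)%N -> actE M i b = 0.
Hypothesis Tb : forall i, (0 < i < n)%N ->
  actKt M i b = q ^ ((lam i)%:Z - (lam i.+1)%:Z) *: b.

(** [Psi_maximal] for operators and weight translated by [k], with [a] taken from [lam] itself so
    that the scalar becomes 1. *)
Lemma Psi_shift_maximal k m : (k + m < n)%N ->
  ((0 < m)%N -> (lam (m + k).+1 < lam (m + k))%N) ->
  (forall i, (k.+1 < i < n)%N -> actE M i (Psi_shift q M lam k m b) = 0) /\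
  ((0 < m)%N -> actE M k.+1 (Psi_shift q M lam k m b) = Psi_shift q M lam k.+1 m.-1 b).
Proof.
move=> kmn strict.
have Rk : qrel q (n - k) (actE M \o addn^~ k) (actF M \o addn^~ k)
     (actKt M \o addn^~ k) (actKti M \o addn^~ k).
  by apply: (qrel_reindex (n := n)) R => // i; lia.
have := @Psi_maximal _ _ hq0 hq _ _ _ _ _ _ (fun i => lam (i + k)%N) m b
  ((lam (1 + k)%N)%:Z - (lam (2 + k)%N)%:Z) Rk.
case=> //.
- lia.
- by move=> i hi; rewrite addSn dom // ltn_addr.
- by move=> i hi /=; rewrite Eb //; lia.
- by move=> hi /=; rewrite Tb //; lia.
- by move=> i hi /=; rewrite Tb //; lia.
move=> H1 H2; split=> [i hi|m0].
  by have := H1 (i - k)%N; rewrite /= subnK; [apply; lia|lia].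
rewrite [LHS]H2 // (Psi_dE (fun i => lam (i + k)%N) m0) divff.
  rewrite scale1r; apply: (Psi_ext hq0 hq) => i /=; by rewrite addnS.
apply: (qint_Psi_d_neq0 hq0 hq) => //; last exact: strict.
by move=> i hi; rewrite addSn dom // ltn_addr.
Qed.

(** Checked at each [v_k]. For [k < i] the operator [E_i] kills the [Psi] term; for [i < k] it
    commutes with every [F_j] in it; for [k = i] the factor [-q^-1] in [Phi] makes the component at
    [v_(i+1)] cancel [q E_i] of the one at [v_i]. *)
Lemma Phi_maximal m i : (0 < m <= n)%N ->
  ((1 < m)%N -> (lam m < lam m.-1)%N) -> (0 < i < n)%N ->
  actE VM i (Phi q n lam m b) = 0.
Proof.
move=> hm strict hi; apply: co_inj => k hk; rewrite linear0 co_E //.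
have hi1 : (0 < i.+1 <= n)%N by lia.
have mn : (m <= n)%N by lia.
rewrite (co_Phi hk mn) (co_Phi hi1 mn).
case: (leqP k m) => km; last first.
  rewrite linear0 scaler0 addr0; case: eqVneq => [e|_]; last by rewrite scale0r.
  have -> : (i < m)%N = false by lia. by rewrite scaler0.
rewrite linearZ /=.
have km1 : (k - 1 + (m - k) < n)%N by lia.
(* For every [k] the shift [k - 1] and the length [m - k] add up to [m - 1], so one strict
   inequality serves all components. *)
have strict' : (0 < m - k)%N ->
    (lam (m - k + (k - 1)).+1 < lam (m - k + (k - 1)))%N.
  move=> mk; have -> : (m - k + (k - 1))%N = m.-1 by lia.
  by rewrite prednK ?strict; lia.
have [H1 H2] := Psi_shift_maximal km1 strict'.
case: (ltngtP k i) => [ki|ik|ki].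
- by rewrite scale0r add0r H1 ?scaler0 //; lia.
- rewrite scale0r add0r /Psi_shift (Psi_comm hq0 hq) => [|j y hj].
    by rewrite Eb // linear0 !scaler0.
  by apply: (EX_neq R); lia.
- rewrite -ki scale1r; have -> : Kexp k k = 1 by rewrite /Kexp; lia.
  case: (ltnP k m) => mk; last first.
    have -> : (m - k)%N = 0%N by lia.
    by rewrite /Psi_shift /= id_lfunE ki Eb // !scaler0 addr0.
  have -> : actE M k = actE M (k - 1).+1 by congr (actE M _); lia.
  rewrite H2 ?subn_gt0 //.
  have -> : (k - 1).+1 = k by lia.
  rewrite subn1 /=; have -> : (m - k)%N = (m - k.+1).+1 by lia.
  by rewrite exprS expr1z scalerA mulrA mulrN mulfV // mulN1r scaleNr subrr.
Qed.

(** The sum telescopes: [F_(k+1), ..., F_(k+l)] together move one unit of weight from row [k + 1] to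
    row [k + l + 1]. *)
Lemma sum_Aexp i k l : \sum_(j < l) - Aexp i (j.+1 + k) =
  ((i == (l + k).+1)%:Z - (i.+1 == (l + k).+1)%:Z) - ((i == k.+1)%:Z - (i.+1 == k.+1)%:Z).
Proof.
elim: l => [|l IH]; first by rewrite big_ord0 add0n subrr.
by rewrite big_ord_recr /= IH /Aexp /Kexp !addSn; lia.
Qed.

(** In the term at [v_k] the operators [F_k, ..., F_(m-1)] move one unit from row [k] to row [m],
    and [v_k] restores row [k]; so all terms have the same weight. *)
Lemma Phi_weight m i : (0 < m <= n)%N -> (0 < i < n)%N ->
  actKt VM i (Phi q n lam m b) =
    q ^ ((lam i + (i == m))%:Z - (lam i.+1 + (i.+1 == m))%:Z) *: Phi q n lam m b.
Proof.
move=> hm hi; apply: co_inj => k hk; have mn : (m <= n)%N by lia.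
rewrite co_Kt // linearZ /= (co_Phi hk mn); case: leqP => km; last first.
  by rewrite linear0 !scaler0.
rewrite linearZ /= /Psi_shift.
rewrite (@Psi_qcomm _ _ hq0 hq _ _ _ (fun j => - Aexp i (j + (k - 1)))); last first.
  by move=> j y hj; apply: (qr_TX R); lia.
rewrite sum_Aexp Tb //; set P := Psi _ _ _ _.
rewrite [P (_ *: b)]linearZ /= !scalerA; congr (_ *: _).
rewrite [q ^ Kexp k i * _]mulrC -!mulrA [RHS]mulrC -!expfzDr //; congr (_ * q ^ _).
by rewrite /Kexp; lia.
Qed.

End Phi.

(** * Lattice words *)

Section Independence.
Variables (F : fieldType) (V : vectType F) (T : eqType) (f : T -> V).

Lemma span_mapP (l : seq T) v : uniq l -> v \in <<map f l>>%VS ->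
  exists a : T -> F, v = \sum_(s <- l) a s *: f s.
Proof.
elim: l v => [|x l IH] v /=.
  by rewrite span_nil memv0 => _ /eqP->; exists (fun=> 0); rewrite big_nil.
case/andP=> xl ul; rewrite span_cons => /memv_addP[_ /vlineP[c ->] [w /(IH _ ul)[a ->] ->]].
exists (fun s => if s == x then c else a s); rewrite big_cons eqxx; congr (_ + _).
apply: eq_big_seq => s sl; case: eqP => // sx; by rewrite -sx sl in xl.
Qed.

Lemma free_map (l : seq T) : uniq l ->
  (forall a : T -> F, \sum_(s <- l) a s *: f s = 0 -> {in l, forall s, a s = 0}) ->
  free (map f l).
Proof.
elim: l => [|x l IH] /=; first by rewrite nil_free.
case/andP=> xl ul h; have nx s : s \in l -> (s == x) = false.
  by move=> sl; apply/negbTE; apply: contraNneq xl => <-.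
rewrite free_cons IH // ?andbT => [|a ha s sl].
  apply/negP => /(span_mapP ul)[a ea].
  have := h (fun s => if s == x then -1 else a s).
  rewrite big_cons eqxx scaleN1r (eq_big_seq (fun s => a s *: f s)); last first.
    by move=> s sl; rewrite /= nx.
  rewrite -ea addNr => /(_ erefl x (mem_head _ _)) /eqP.
  by rewrite eqxx oppr_eq0 oner_eq0.
have := h (fun s => if s == x then 0 else a s).
rewrite big_cons eqxx scale0r add0r (eq_big_seq (fun s => a s *: f s)).
  by move/(_ ha s); rewrite in_cons sl orbT nx // => ->.
by move=> t tl; rewrite nx.
Qed.

End Independence.

(** A word stands for the diagram whose row [i] has as many boxes as [i] has occurrences; the test
    says that row [m] may grow. *)
Definition addable (s : seq nat) (m : nat) : bool :=
  (m == 1%N) || (count_mem m s < count_mem m.-1 s)%N.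

(* Rows of the successively added boxes, the last one first. *)
Fixpoint words (n k : nat) : seq (seq nat) :=
  if k is k'.+1 then
    [seq m :: s | s <- words n k', m <- [seq m <- iota 1 n | addable s m]]
  else [:: [::]].

Definition rect n (s : seq nat) : bool :=
  all (fun i => count_mem i s == count_mem i.+1 s) (iota 1 n.-1).

Lemma wordsP n k (s : seq nat) : reflect
  (exists (m : nat) (t : seq nat), [/\ s = m :: t, t \in words n k, (0 < m <= n)%N & addable t m])
  (s \in words n k.+1).
Proof.
apply: (iffP allpairsPdep) => [[t [m []]]|[m [t [-> tw mn ad]]]].
  by rewrite mem_filter mem_iota add1n ltnS => tw /andP[ad mn] ->; exists m, t.
by exists t, m; split=> //; rewrite mem_filter ad mem_iota add1n ltnS.
Qed.

Lemma uniq_words n k : uniq (words n k).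
Proof.
elim: k => // k IH /=; apply: allpairs_uniq_dep => // [s _|].
  by rewrite filter_uniq // iota_uniq.
by move=> [s m] [s' m'] _ _ /= [-> ->].
Qed.

Lemma words_dom n k (s : seq nat) : s \in words n k -> forall i, (0 < i)%N ->
  (count_mem i.+1 s <= count_mem i s)%N.
Proof.
elim: k s => [|k IH] s; first by rewrite inE => /eqP->.
case/wordsP => m [t [-> tw mn ad]] i i0 /=; move: (IH t tw i i0).
case: (eqVneq m i.+1) ad => [->|ne] ad Ht; last exact: leq_trans Ht (leq_addl _ _).
rewrite (gtn_eqF (ltnSn i)) !add0n add1n.
by move: ad; rewrite /addable eqSS (gtn_eqF i0).
Qed.

Lemma rectP n s : reflect (forall i, (0 < i < n)%N -> count_mem i s = count_mem i.+1 s)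
  (rect n s).
Proof.
apply: (iffP allP) => h i hi.
  by apply/eqP/h; rewrite mem_iota; lia.
by apply/eqP/h; move: hi; rewrite mem_iota; lia.
Qed.

Lemma sum_words (V : nmodType) n k (G : seq nat -> V) :
  \sum_(s <- words n k.+1) G s =
  \sum_(t <- words n k) \sum_(m <- iota 1 n | addable t m) G (m :: t).
Proof.
by rewrite [LHS]big_allpairs_dep; apply: eq_bigr => t _; rewrite big_filter.
Qed.

(** * Maximal vectors and invariants in the tensor powers *)

Section Words.
Variables (F : fieldType) (q : F) (n : nat).
Hypotheses (hq0 : q != 0) (hq : forall k : nat, (0 < k)%N -> q ^+ k != 1).

(** The vector [c_pi] in terms of words: dropping the last box is [behead], while the type of a walk
    fixes its length. *)
Fixpoint cword (k : nat) (s : seq nat) : Vq_pow q n k :=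
  match k return Vq_pow q n k with
  | 0 => 1 : F^o
  | j.+1 => Phi q n (fun i => count_mem i (behead s)) (head 0%N s) (cword j (behead s))
  end.

Arguments cword : simpl never.

Lemma Vq_pow_rel k : uq_rel q n (Vq_pow q n k).
Proof.
elim: k => [|k IH]; first exact: uq_rel_triv.
exact: (uq_rel_tens hq0 hq IH).
Qed.

Lemma Vq_pow_nilpotent k : F_nilpotent n (Vq_pow q n k).
Proof.
elim: k => [|k IH]; first exact: F_nilpotent_triv.
exact: (F_nilpotent_tens hq0 IH).
Qed.

Lemma cword_maximal k (s : seq nat) : s \in words n k ->
  (forall i, (0 < i < n)%N -> actE (Vq_pow q n k) i (cword k s) = 0) /\
  (forall i, (0 < i < n)%N -> actKt (Vq_pow q n k) i (cword k s) =
     q ^ ((count_mem i s)%:Z - (count_mem i.+1 s)%:Z) *: cword k s).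
Proof.
elim: k s => [|k IH] s.
  rewrite inE => /eqP->; split=> i hi; first by rewrite /= zero_lfunE.
  by rewrite /= /actKt comp_lfunE !id_lfunE expr0z scale1r.
case/wordsP => m [t [-> tw mn ad]]; have [Et Tt] := IH t tw.
have R := Vq_pow_rel k; have dom := words_dom tw.
split=> i hi.
  apply: (Phi_maximal hq0 hq R dom Et Tt mn) => // m1.
  by move: ad; rewrite /addable; case: eqP m1 => // ->.
rewrite [LHS](Phi_weight hq0 hq R Tt mn hi) /=.
by congr (q ^ _ *: _); rewrite ![_ == m]eq_sym ![(_ + (m == _))%N]addnC.
Qed.

(** [F_i] of this vector is again killed by [E_i], the weight for [T_i] being 0, and it has weight
    -2; nilpotency of [F_i] then forces it to be 0. *)
Lemma cword_F k (s : seq nat) i : s \in words n k -> (0 < i < n)%N ->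
  count_mem i s = count_mem i.+1 s -> actF (Vq_pow q n k) i (cword k s) = 0.
Proof.
move=> sw hi e; have [Es /(_ i hi)] := cword_maximal sw; rewrite e subrr => Ts.
have R := Vq_pow_rel k; have [d hd] := Vq_pow_nilpotent k.
apply: (maximal_weightN2_eq0 hq0 hq R hi (hd i hi)).
  by rewrite (EX_weight hq0 R hi Ts) Es // linear0 qint0 scale0r addr0.
by rewrite (qr_TX R) // Ts expr0z scale1r Aexpii.
Qed.

(** The triangularity behind independence and spanning: the component at [v_m] recovers the vector
    of the shorter word. *)
Lemma co_cwordS k m (t : seq nat) p : (0 < p <= n)%N -> (m <= n)%N ->
  (m <= p)%N -> co p (cword k.+1 (m :: t)) = (m == p)%:R *: cword k t.
Proof.
move=> hp mn mp; rewrite [cword _ _]/(Phi _ _ _ _ _) co_Phi //=.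
case: leqP => pm; last by rewrite (_ : (m == p) = false) ?scale0r //; lia.
have -> : m = p by lia.
by rewrite subnn expr0 scale1r eqxx scale1r /Psi_shift id_lfunE.
Qed.

Lemma cword_indep k (a : seq nat -> F) :
  \sum_(s <- words n k) a s *: cword k s = 0 -> {in words n k, forall s, a s = 0}.
Proof.
elim: k a => [|k IH] a.
  rewrite big_seq1 => /eqP; rewrite scaler_eq0 oner_eq0 orbF => /eqP a0 s.
  by rewrite inE => /eqP->.
rewrite sum_words => h0.
(* Descending induction on the row [m], with [d > n - m]. At [v_m] larger rows already have
   coefficient 0 and smaller rows have no component, so only words starting with [m] contribute. *)
suff key d (m : nat) (t : seq nat) : (n < m + d)%N -> (0 < m <= n)%N -> t \in words n k -> addable t m ->
    a (m :: t) = 0.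
  move=> s /wordsP[m [t [-> tw mn ad]]]; apply: (key n) => //; lia.
elim: d m t => [|d IHd] m t md mn tw ad; first lia.
have /(_ _ t tw) := IH (fun t => if addable t m then a (m :: t) else 0); rewrite ad; apply.
have e0 : co m (0 : Vq_pow q n k.+1) = 0 by exact: linear0.
rewrite -[RHS]e0 -h0 linear_sum; apply: eq_big_seq => u uw.
rewrite linear_sum /= big_mkcond (bigD1_seq m) ?iota_uniq //=; last first.
  by rewrite mem_iota add1n ltnS.
rewrite big1_seq ?addr0 => [|p /andP[pm]].
  by case: ifP => _; rewrite ?scale0r // linearZ /= co_cwordS ?eqxx ?scale1r //; lia.
rewrite mem_iota add1n ltnS => hp; case: ifP => // adp; rewrite linearZ /=.
case: (ltnP p m) => pltm.
  by rewrite co_cwordS ?(negbTE pm) ?scale0r ?scaler0 //; lia.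
by rewrite IHd ?scale0r //; lia.
Qed.

Lemma cword_span k (w : Vq_pow q n k) :
  (forall i, (0 < i < n)%N -> actE (Vq_pow q n k) i w = 0) ->
  w \in <<[seq cword k s | s <- words n k]>>%VS.
Proof.
elim: k w => [|k IH] w Ew.
  by rewrite span_seq1; apply/vlineP; exists (w : F); rewrite [RHS]mulr1.
have R := Vq_pow_rel k.
(* Induction on a bound [m] for the index of the last nonzero component. *)
suff key m (x : Vq_pow q n k.+1) : (m <= n)%N ->
    (forall i, (0 < i < n)%N -> actE (Vq_pow q n k.+1) i x = 0) ->
    (forall p, (m < p <= n)%N -> co p x = 0) ->
    x \in <<[seq cword k.+1 s | s <- words n k.+1]>>%VS.
  by apply: (key n) => // p; lia.
elim: m x => [|m IHm] x mn Ex x0.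
  suff -> : x = 0 by exact: mem0v.
  by apply: co_inj => p hp; rewrite x0 // linear0.
have comp y : (forall i, (0 < i < n)%N -> actE (Vq_pow q n k.+1) i y = 0) ->
    forall p i, (0 < p <= n)%N -> (0 < i < n)%N ->
    (p == i)%:R *: co i.+1 y + q ^ Kexp p i *: actE (Vq_pow q n k) i (co p y) = 0.
  by move=> Ey p i hp hi; rewrite -co_E // Ey // linear0.
have hm1 : (0 < m.+1 <= n)%N by lia.
(* As the next component vanishes, [co m.+1 x] is itself maximal. *)
have /(span_mapP (uniq_words n k))[a ea] :
    co m.+1 x \in <<[seq cword k s | s <- words n k]>>%VS.
  apply: IH => i hi; have := comp x Ex m.+1 i hm1 hi.
  case: eqVneq => [e|_].
    rewrite -e x0; last by lia.
    rewrite scaler0 add0r => /eqP; rewrite scaler_eq0 expfz_eq0 (negbTE hq0) andbF.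
    by move/eqP.
  rewrite scale0r add0r => /eqP; rewrite scaler_eq0 expfz_eq0 (negbTE hq0) andbF.
  by move/eqP.
(* Only words that admit a box in row [m + 1] can be lifted; the other terms remain in the component
   [y] of [x - z], shown below to be 0. *)
pose z : Vq_pow q n k.+1 :=
  \sum_(t <- words n k | addable t m.+1) a t *: cword k.+1 (m.+1 :: t).
have zspan : z \in <<[seq cword k.+1 s | s <- words n k.+1]>>%VS.
  rewrite /z big_seq_cond; apply: rpred_sum => t /andP[tw ad]; apply: rpredZ.
  apply: memv_span; apply/mapP; exists (m.+1 :: t) => //.
  by apply/wordsP; exists m.+1, t.
rewrite -(subrK z x) rpredD //.
have Ez i : (0 < i < n)%N -> actE (Vq_pow q n k.+1) i z = 0.
  move=> hi; rewrite linear_sum big_seq_cond big1 // => t /andP[tw ad].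
  rewrite linearZ /=.
  have [|->] := @cword_maximal k.+1 (m.+1 :: t); rewrite ?scaler0 //.
  by apply/wordsP; exists m.+1, t.
have Exz i : (0 < i < n)%N -> actE (Vq_pow q n k.+1) i (x - z) = 0.
  by move=> hi; rewrite linearB /= Ex // Ez // subrr.
apply: IHm => //; first by lia.
have z0 p : (m.+1 < p <= n)%N -> co p z = 0.
  move=> hp; rewrite linear_sum big1 // => t _.
  rewrite linearZ /= co_cwordS; try lia.
  by rewrite (_ : (m.+1 == p) = false) ?scale0r ?scaler0 //; lia.
move=> p hp; case: (eqVneq p m.+1) => [->|pm]; last first.
  by rewrite linearB /= x0 ?z0 ?subrr //; lia.
pose y := co m.+1 (x - z).
have ey : y = \sum_(t <- words n k | ~~ addable t m.+1) a t *: cword k t.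
  have ez : co m.+1 z = \sum_(t <- words n k | addable t m.+1) a t *: cword k t.
    rewrite linear_sum; apply: eq_bigr => t _.
    by rewrite linearZ /= co_cwordS ?eqxx ?scale1r.
  by rewrite /y linearB /= ez ea (bigID (addable^~ m.+1)) /= addrAC subrr add0r.
(* Row 1 can always grow, so nothing is left over for [m = 0]. *)
rewrite -/y; case: (posnP m) => [m0|m0].
  by rewrite ey big1 // => t; rewrite m0.
have hm : (0 < m < n)%N by lia.
(* In the remaining words rows [m] and [m + 1] have equal length, so [F_m] kills [y] and [T_m] fixes
   it. *)
have na t : t \in words n k -> ~~ addable t m.+1 -> count_mem m t = count_mem m.+1 t.
  move=> tw; rewrite /addable /= eqSS (gtn_eqF m0) /= -leqNgt => h.
  by apply/eqP; rewrite eqn_leq h (words_dom tw).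
pose E := actE (Vq_pow q n k) m; pose X := actF (Vq_pow q n k) m.
pose T := actKt (Vq_pow q n k) m; pose u := co m (x - z).
have Xy : X y = 0.
  rewrite ey linear_sum big_seq_cond big1 // => t /andP[tw ad].
  by rewrite linearZ /= cword_F ?scaler0 //; apply: na.
have Ty : T y = y.
  rewrite ey linear_sum big_seq_cond [RHS]big_seq_cond; apply: eq_bigr => t /andP[tw ad].
  have [_ Tt] := cword_maximal tw.
  by rewrite linearZ /= Tt // na // subrr expr0z scale1r.
have hm0 : (0 < m <= n)%N by lia.
(* Maximality of [x - z], read at [v_m], makes [y] a multiple of [E_m u], to which the weight 0
   string argument applies. *)
have yE : y = - (q *: E u).
  have := comp _ Exz m m hm0 hm; rewrite eqxx scale1r.
  have -> : Kexp m m = 1 by rewrite /Kexp; lia.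
  by rewrite expr1z => /eqP; rewrite addr_eq0 => /eqP.
have Eu : E u = - (q^-1 *: y).
  by rewrite yE scalerN opprK scalerA mulVf // scale1r.
have [d hd] := Vq_pow_nilpotent k.
rewrite yE (E_eq0_of_weight0 hq0 hq R hm (hd m hm)) ?scaler0 ?oppr0 //.
  by rewrite -/E -/X -/u Eu linearN linearZ /= Xy scaler0 oppr0.
by rewrite -/E -/T -/u Eu linearN linearZ /= Ty.
Qed.

Lemma memv_invariants (M : uq_ops F) (w : M) : reflect
  (forall i, (0 < i < n)%N -> [/\ actE M i w = 0, actF M i w = 0 & actKt M i w = w])
  (w \in invariants n M).
Proof.
have cap (r : seq nat) (U : nat -> {vspace M}) :
    (w \in (\bigcap_(i <- r) U i)%VS) = all (fun i => w \in U i) r.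
  elim: r => [|i r IH]; first by rewrite big_nil memvf.
  by rewrite big_cons memv_cap IH.
rewrite /invariants cap.
apply: (iffP allP) => h i hi.
  have := h i; rewrite mem_index_iota => /(_ hi); rewrite !memv_cap (memv_ker (actE M i)) (memv_ker (actF M i)).
  by case/andP=> /andP[/eqP e /eqP f] /fixedSpaceP t.
rewrite mem_index_iota in hi; have [e f t] := h i hi.
by rewrite !memv_cap (memv_ker (actE M i)) (memv_ker (actF M i)) e f eqxx; apply/fixedSpaceP.
Qed.

Lemma words_basis r :
  basis_of (invariants n (Vq_pow q n r)) [seq cword r s | s <- words n r & rect n s].
Proof.
rewrite /basis_of eqEsubv -andbA; apply/and3P; split.
- apply/span_subvP => v /mapP[s]; rewrite mem_filter => /andP[/rectP rs sw] ->.
  apply/memv_invariants => i hi; have [Es Ts] := cword_maximal sw.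
  by rewrite Es // Ts // cword_F // rs // subrr expr0z scale1r.
- apply/subvP => w /memv_invariants winv.
  have /(span_mapP (uniq_words n r))[a ea] : w \in <<[seq cword r s | s <- words n r]>>%VS.
    by apply: cword_span => i /winv[].
  (* On a non-rectangular word some [T_i] has an eigenvalue other than 1. Since [T_i - 1] kills [w]
     and multiplies [a s] by a nonzero scalar, independence yields [a s = 0]. *)
  have a0 s : s \in words n r -> ~~ rect n s -> a s = 0.
    move=> sw nrs; case: (boolP [exists i : 'I_n, (0 < i)%N && (count_mem (val i) s != count_mem i.+1 s)]).
      case/existsP=> i /andP[i0 ni]; have hi : (0 < i < n)%N by rewrite i0 /=.
      have [_ _ Tw] := winv i hi.
      pose c t : F := q ^ ((count_mem (val i) t)%:Z - (count_mem i.+1 t)%:Z) - 1.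
      have /cword_indep/(_ s sw)/eqP : \sum_(t <- words n r) (a t * c t) *: cword r t = 0.
        have Te : actKt (Vq_pow q n r) i w - w = 0 by rewrite Tw subrr.
        rewrite -[RHS]Te ea [X in X - _]linear_sum -sumrB; apply: eq_big_seq => t tw.
        have [_ Tt] := cword_maximal tw.
        by rewrite linearZ /= Tt // -scalerA -scalerBr scalerBl scale1r.
      rewrite mulf_eq0 subr_eq0 expqz_eq1 // subr_eq0 => /orP[/eqP//|/eqP[e]].
      by rewrite e eqxx in ni.
    move/existsPn => h; case/negP: nrs; apply/rectP => i hi.
    have iltn : (i < n)%N by lia.
    by have := h (Ordinal iltn); rewrite /= negb_and negbK -leqNgt; case/orP => [|/eqP//]; lia.
  rewrite ea big_seq; apply: rpred_sum => s sw.
  have [rs|/a0->//] := boolP (rect n s); last by rewrite scale0r mem0v.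
  apply: rpredZ; apply: memv_span; apply/mapP; exists s => //.
  by rewrite mem_filter rs.
- apply: free_map; first by rewrite filter_uniq // uniq_words.
  move=> a; rewrite big_filter big_mkcond => ha s; rewrite mem_filter => /andP[rs sw].
  have /cword_indep/(_ s sw) :
      \sum_(t <- words n r) (if rect n t then a t else 0) *: cword r t = 0.
    by rewrite -[RHS]ha; apply: eq_bigr => t _; case: ifP; rewrite ?scale0r.
  by rewrite rs.
Qed.

End Words.

(** * Walks as lattice words *)

Section WalkWords.
Variables n r : nat.
Implicit Types (pi : walk n r) (s : seq nat).

Fixpoint walk_word pi (k : nat) : seq nat :=
  if k is j.+1 then box_row pi j :: walk_word pi j else [::].

Lemma wpart_ord pi j (k : 'I_n) : wpart pi j k.+1 = val pi (inord j) k.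
Proof. by rewrite /wpart (big_pred1 k) // => i /=; rewrite eqSS. Qed.

Lemma wpart_out pi j i : ~~ (0 < i <= n)%N -> wpart pi j i = 0%N.
Proof.
by move=> hi; rewrite /wpart big_pred0 // => k; apply/negbTE; move: (ltn_ord k); lia.
Qed.

Lemma wpart_leq pi j i : (0 < i)%N -> (j <= r)%N -> (wpart pi j i.+1 <= wpart pi j i)%N.
Proof.
move=> i0 jr; case: (ltnP i n) => hi; last by rewrite wpart_out //; lia.
case: i i0 hi => // i _ hi; have hi' : (i < n)%N by lia.
have /andP[/forallP/(_ (inord j))/andP[/forallP/(_ (Ordinal hi'))/forallP/(_ (Ordinal hi)) h _] _] := valP pi.
rewrite (wpart_ord pi j (Ordinal hi)) (wpart_ord pi j (Ordinal hi')).
by move: h => /implyP; apply => /=.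
Qed.

Lemma wpart0 pi i : wpart pi 0 i = 0%N.
Proof.
have [hi|hi] := boolP (0 < i <= n)%N; last exact: wpart_out.
case: i hi => // i hi; rewrite (wpart_ord pi 0 (Ordinal hi)).
have /andP[/forallP/(_ (inord 0))/andP[_ /eqP]] := valP pi.
rewrite inordK // => /eqP; rewrite sum_nat_eq0 => /forallP/(_ (Ordinal hi)) /=.
by move/eqP.
Qed.

Lemma wpartS pi j : (j < r)%N -> exists2 x, (0 < x <= n)%N &
  forall i, (0 < i <= n)%N -> wpart pi j.+1 i = (wpart pi j i + (i == x))%N.
Proof.
move=> jr; have /andP[_ /forallP/(_ (Ordinal jr))/existsP[k /forallP hk]] := valP pi.
exists k.+1; first by rewrite ltn_ord.
case=> // i hi; have := hk (Ordinal hi).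
have -> : widen_ord (leqnSn r) (Ordinal jr) = inord j by apply: val_inj; rewrite /= inordK //; lia.
have -> : lift ord0 (Ordinal jr) = inord j.+1 by apply: val_inj; rewrite /= inordK //; lia.
by rewrite -!wpart_ord => /eqP->; rewrite eqSS.
Qed.

(** Only row [x] grows, so the search stops there; [find] counts from 0 and rows from 1. *)
Lemma box_row_eq pi j x : (0 < x <= n)%N ->
  (forall i, (0 < i <= n)%N -> wpart pi j.+1 i = (wpart pi j i + (i == x))%N) ->
  box_row pi j = x.
Proof.
case: x => // x hx h; rewrite /box_row; congr _.+1.
rewrite (@eq_in_find _ _ (pred1 x.+1)) => [|i].
  rewrite -[RHS](index_uniq 0%N (s := iota 1 n)) ?size_iota ?iota_uniq //.
  by rewrite nth_iota.
by rewrite mem_iota add1n ltnS => hi; rewrite h // -[X in (X < _)%N]addn0 ltn_add2l lt0b.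
Qed.

Lemma box_row_step pi j : (j < r)%N -> (0 < box_row pi j <= n)%N /\
  forall i, (0 < i <= n)%N -> wpart pi j.+1 i = (wpart pi j i + (i == box_row pi j))%N.
Proof. by case/(wpartS pi) => x hx h; rewrite (box_row_eq hx h). Qed.

Lemma wpartE pi j i : (j <= r)%N -> wpart pi j i = count_mem i (walk_word pi j).
Proof.
elim: j => [|j IH] jr; first by rewrite wpart0.
have [hb hw] := box_row_step pi jr.
have [hi|hi] := boolP (0 < i <= n)%N.
  by rewrite hw // IH ?(ltnW jr) //= addnC eq_sym.
rewrite wpart_out //= -IH ?(ltnW jr) // wpart_out // addn0.
by case: eqP hi => // <-; rewrite hb.
Qed.

(** Each new box is addable because the next vertex is again a partition. *)
Lemma walk_word_words pi j : (j <= r)%N -> walk_word pi j \in words n j.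
Proof.
elim: j => [|j IH] jr; first by rewrite inE.
have [hb hw] := box_row_step pi jr.
apply/wordsP; exists (box_row pi j), (walk_word pi j); split=> //; first exact/IH/ltnW.
rewrite /addable; case: eqP => // /eqP b1; rewrite -!wpartE ?(ltnW jr) //.
move: hb hw b1; case: (box_row pi j) => [|[|b]] // hb hw _ /=.
have h1 := hw b.+2 hb; have h2 := hw b.+1 (ltnW hb).
by move: (@wpart_leq pi j.+1 b.+1 isT jr); rewrite h1 h2 eqxx ltn_eqF // addn0 addn1.
Qed.

Lemma walk_word_drop pi k : (k <= r)%N -> walk_word pi k = drop (r - k) (walk_word pi r).
Proof.
move=> kr; rewrite -{2}(subnK kr); elim: (r - k)%N => [|d IH]; first by rewrite drop0.
by rewrite addSn /= -IH.
Qed.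

(** The initial pieces of a walk have the suffixes of its word as words, and the counts in these
    give back every vertex. *)
Lemma walk_word_inj : injective (walk_word^~ r).
Proof.
move=> pi pi' e; apply: val_inj; apply/ffunP => j; apply/ffunP => k.
have jr : (j <= r)%N by rewrite -ltnS.
apply: ord_inj; rewrite -[j]inord_val -!wpart_ord !wpartE //.
by rewrite walk_word_drop // [in RHS]walk_word_drop // e.
Qed.

Lemma words_size m k s : s \in words m k -> size s = k.
Proof.
elim: k s => [|k IH] s; first by rewrite inE => /eqP->.
by case/wordsP => x [t [-> tw _ _]] /=; rewrite (IH t).
Qed.

Lemma words_drop m k s d : (d <= k)%N -> s \in words m k -> drop d s \in words m (k - d).
Proof.
elim: d k s => [|d IH] k s dk sw; first by rewrite drop0 subn0.
case: k dk sw => // k dk /wordsP[x [t [-> tw _ _]]] /=.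
exact: IH.
Qed.

Lemma words_sum m k s : s \in words m k -> (\sum_(i < m) count_mem i.+1 s = k)%N.
Proof.
elim: k s => [|k IH] s; first by rewrite inE => /eqP->; rewrite big1.
case/wordsP => x [t [-> tw hx _]] /=; rewrite big_split /= IH //.
case: x hx => // x hx; rewrite (bigD1 (Ordinal hx)) //= eqxx big1 // => i hi.
by rewrite eqSS eq_sym (negbTE (_ : i != x :> nat)).
Qed.

(** The [j]-th vertex is read off the last [j] letters of [s], which are the first [j] boxes. *)
Lemma walk_word_surj s : s \in words n r -> exists pi, walk_word pi r = s.
Proof.
move=> sw; have szs := words_size sw.
pose cnt (j i : nat) := count_mem i (drop (r - j) s).
have cntr j i : (cnt j i < r.+1)%N.
  by rewrite ltnS (leq_trans (count_size _ _)) // size_drop szs leq_subr.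
pose w : {ffun 'I_r.+1 -> {ffun 'I_n -> 'I_r.+1}} :=
  [ffun j : 'I_r.+1 => [ffun i : 'I_n => Ordinal (cntr j i.+1)]].
have wE j i : w j i = cnt j i.+1 :> nat by rewrite !ffunE.
have dw j : (j <= r)%N -> drop (r - j) s \in words n j.
  by move=> jr; rewrite -{2}(subKn jr); apply: words_drop; rewrite ?leq_subr.
have step j : (j < r)%N -> exists2 x, (0 < x <= n)%N &
    drop (r - j.+1) s = x :: drop (r - j) s.
  move=> jr; have /wordsP[x [t [e tw hx _]]] := dw j.+1 jr; exists x => //.
  by rewrite e -(subnSK jr) -add1n -drop_drop e /= drop0.
have ww : is_walk w.
  apply/andP; split; apply/forallP => j.
    have jr : (j <= r)%N by rewrite -ltnS.
    apply/andP; split.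
      apply/forallP => i; apply/forallP => k; apply/implyP; rewrite !wE /cnt => ik.
      have dom := words_dom (dw j jr).
      have := leq_ltn_trans ik (ltn_ord k) => _.
      rewrite -(subnK ik); elim: (k - i)%N => [|d IH] //.
      by rewrite addSn; apply: leq_trans IH; apply: dom.
    rewrite (eq_bigr (fun i : 'I_n => count_mem i.+1 (drop (r - j) s))) => [|i _].
      by rewrite (words_sum (dw j jr)).
    by rewrite wE.
  have [x hx e] := step j (ltn_ord j); case: x hx e => // x hx e.
  apply/existsP; exists (Ordinal hx); apply/forallP => i.
  by rewrite !wE /cnt /= e /= addnC eqSS [x == i]eq_sym.
exists (Sub w ww); set pi : walk n r := Sub w ww.
have wp j i : (j <= r)%N -> (0 < i <= n)%N -> wpart pi j i = cnt j i.
  by move=> jr; case: i => // i hi; rewrite (wpart_ord pi j (Ordinal hi)) wE inordK.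
suff key k : (k <= r)%N -> walk_word pi k = drop (r - k) s.
  by rewrite key // subnn drop0.
elim: k => [|k IH] kr; first by rewrite subn0 drop_oversize ?szs.
have [x hx e] := step k kr; rewrite /= IH ?(ltnW kr) // e; congr (_ :: _).
apply: box_row_eq => // i hi; rewrite !wp ?(ltnW kr) //.
by rewrite /cnt e /= addnC eq_sym.
Qed.

(** Equality of neighbouring rows is propagated from the first row, which supplies the common
    value. *)
Lemma to_rectangleE pi : (0 < n)%N -> to_rectangle pi = rect n (walk_word pi r).
Proof.
move=> n0; have inr : inord r = ord_max :> 'I_r.+1 by apply: val_inj; rewrite /= inordK.
have wo (i : 'I_n) : count_mem i.+1 (walk_word pi r) = val pi ord_max i.
  by rewrite -wpartE // wpart_ord inr.
apply/idP/rectP => [/existsP[j /forallP h] [//|i] hi|h].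
  have hi' : (i < n)%N by lia.
  have hi1 : (i.+1 < n)%N by lia.
  by rewrite (wo (Ordinal hi')) (wo (Ordinal hi1)) !(eqP (h _)).
apply/existsP; exists (val pi ord_max (Ordinal n0)); apply/forallP => -[i hi].
rewrite -val_eqE /= -(wo (Ordinal hi)) -(wo (Ordinal n0)) /=.
elim: i hi => // i IH hi; have hi' : (i < n)%N by lia.
by rewrite -h ?IH //.
Qed.

Lemma perm_walk_words : (0 < n)%N ->
  perm_eq [seq walk_word pi r | pi : walk n r in [pred pi | to_rectangle pi]]
    [seq s <- words n r | rect n s].
Proof.
move=> n0; apply: uniq_perm.
- by rewrite map_inj_uniq ?enum_uniq //; exact: walk_word_inj.
- by rewrite filter_uniq // uniq_words.
move=> s; rewrite mem_filter; apply/imageP/andP => [[pi]|[rs sw]].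
  by rewrite inE to_rectangleE // => h ->; rewrite h walk_word_words.
have [pi e] := walk_word_surj sw; exists pi => //.
by rewrite inE to_rectangleE // e.
Qed.

End WalkWords.

(** * Transfer of the basis from words to walks *)

Lemma Phi_ext (F : fieldType) (q : F) (hq0 : q != 0)
    (hq : forall k : nat, (0 < k)%N -> q ^+ k != 1) n (M : uq_ops F) lam mu m (b : M) :
  lam =1 mu -> Phi q n lam m b = Phi q n mu m b.
Proof.
move=> e; apply: eq_bigr => j _; congr (_ *: tens _ _).
by apply: (Psi_ext hq0 hq) => i.
Qed.

Lemma cvecE (F : fieldType) (q : F) (hq0 : q != 0)
    (hq : forall k : nat, (0 < k)%N -> q ^+ k != 1) n r (pi : walk n r) k :
  (k <= r)%N -> cvec q pi k = cword q n k (walk_word pi k).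
Proof.
elim: k => // k IH kr; rewrite [LHS]/= IH ?(ltnW kr) //.
by apply: (Phi_ext hq0 hq) => i; rewrite wpartE // ltnW.
Qed.

Theorem mainTheorem2 (F : fieldType) (q : F) (hq0 : q != 0)
  (hq : forall k : nat, (0 < k)%N -> q ^+ k != 1)
  (n r : nat) (hn : (0 < n)%N) :
  basis_of (invariants n (Vq_pow q n r))
    [seq cwalk q pi | pi : walk n r in [pred pi | to_rectangle pi]].
Proof.
have := @words_basis F q n hq0 hq r.
rewrite -(perm_basis _ (perm_map _ (perm_walk_words r hn))).
have e (pi : walk n r) : cwalk q pi = cword q n r (walk_word pi r).
  exact: (cvecE hq0 hq).
by rewrite -map_comp /image_mem (eq_map e).
Qed.
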